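(* Let $\Bbbk$ be a field and $n\ge 1$. Let $\mathbb{L}_n,\mathbb{U}_n\subset SL_{n+1}$ be the subgroups over $\Bbbk$ of lower, respectively upper, triangular matrices with $1$'s along the diagonal. Then the fibers of the multiplication map $$\mu\colon\mathbb{L}_n\times\mathbb{U}_n\times\mathbb{L}_n\times\mathbb{U}_n\longrightarrow SL_{n+1},\qquad (x,u,y,v)\longmapsto xuyv,$$ are global complete intersections.
   Context: A scheme over a field $K$ is a global complete intersection if it is isomorphic to $\mathrm{Spec}\,K[t_1,\dots,t_m]/(f_1,\dots,f_c)$ for some polynomials $f_1,\dots,f_c$ such that this scheme has dimension $m-c$. The fiber over a point $g_0\in SL_{n+1}$ is regarded as a scheme over the residue field of $g_0$. *)

(* Defs.v *)
From HB Require Import structures.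
From mathcomp Require Import all_boot all_order all_algebra.
From mathcomp Require Import generic_quotient ring_quotient fraction.
From mathcomp Require Import boolp mpoly.

Set Implicit Arguments.
Unset Strict Implicit.
Unset Printing Implicit Defensive.

Import GRing.Theory.

Local Open Scope ring_scope.
Local Open Scope quotient_scope.

(* Affine schemes are handled through their coordinate rings.  The library's  *)
(* [idealr] only covers proper ideals, and hence nonzero quotient rings;      *)
(* the ideals below may be improper, so that the empty scheme is included.    *)

Record ideal (R : comPzRingType) := Ideal {
  ideal_mem :> R -> Prop;
  ideal_zero : ideal_mem 0;
  ideal_add : forall x y, ideal_mem x -> ideal_mem y -> ideal_mem (x + y);
  ideal_mul : forall a x, ideal_mem x -> ideal_mem (a * x) }.

Record prime_ideal (R : comPzRingType) := PrimeIdeal {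
  prime_ideal_val :> ideal R;
  prime_ideal_proper : ~ prime_ideal_val 1;
  prime_ideal_mul : forall x y,
    prime_ideal_val (x * y) -> prime_ideal_val x \/ prime_ideal_val y }.

Section Span.
Variables (R : comPzRingType) (S : R -> Prop).

Definition span_mem (x : R) : Prop :=
  forall I : ideal R, (forall s, S s -> I s) -> I x.

Fact span_zero : span_mem 0.
Proof. by move=> I _; apply: ideal_zero. Qed.

Fact span_add x y : span_mem x -> span_mem y -> span_mem (x + y).
Proof. by move=> Hx Hy I SI; apply: ideal_add; [apply: Hx | apply: Hy]. Qed.

Fact span_mul a x : span_mem x -> span_mem (a * x).
Proof. by move=> Hx I SI; apply: ideal_mul; apply: Hx. Qed.

Definition span : ideal R := Ideal span_zero span_add span_mul.

End Span.

Section QuotientRing.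
Variables (R : comPzRingType) (I : ideal R).

Definition in_ideal : R -> bool := fun x => `[< I x >].

Fact in_ideal_zmod_closed : zmod_closed in_ideal.
Proof.
split=> [|x y /asboolP Ix /asboolP Iy]; apply/asboolP; first exact: ideal_zero.
by apply: ideal_add => //; rewrite -mulN1r; apply: ideal_mul.
Qed.

HB.instance Definition _ :=
  GRing.isZmodClosed.Build R in_ideal in_ideal_zmod_closed.

Definition in_ideal_zmodClosed : zmodClosed R :=
  GRing.ZmodClosed.clone R in_ideal _.

Definition quot_ring : Type := Quotient.quot in_ideal_zmodClosed.

HB.instance Definition _ := GRing.Zmodule.on quot_ring.

Definition quot_proj : R -> quot_ring := \pi_(Quotient.quot in_ideal_zmodClosed).

Lemma quot_projP x y : quot_proj x = quot_proj y <-> I (x - y).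
Proof.
rewrite /quot_proj; split => [/eqP|Ixy].
  by rewrite -Quotient.idealrBE => /asboolP.
by apply/eqP; rewrite -Quotient.idealrBE; apply/asboolP.
Qed.

Lemma quot_proj_repr (x : quot_ring) : quot_proj (repr x) = x.
Proof. exact: reprK. Qed.

Lemma quot_proj_is_zmod_morphism : zmod_morphism quot_proj.
Proof. exact: raddfB. Qed.

HB.instance Definition _ :=
  GRing.isZmodMorphism.Build R quot_ring quot_proj quot_proj_is_zmod_morphism.

Definition quot_one : quot_ring := quot_proj 1.
Definition quot_mul (x y : quot_ring) : quot_ring :=
  quot_proj (repr x * repr y).

Lemma quot_projM : {morph quot_proj : x y / x * y >-> quot_mul x y}.
Proof.
move=> x y; apply/quot_projP.
set x' := repr _; set y' := repr _.
have Ix : I (x - x') by apply/quot_projP; rewrite quot_proj_repr.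
have Iy : I (y - y') by apply/quot_projP; rewrite quot_proj_repr.
have -> : x * y - x' * y' = y * (x - x') + x' * (y - y').
  by rewrite !mulrBr [y * x]mulrC [y * x']mulrC addrA subrK.
by apply: ideal_add; apply: ideal_mul.
Qed.

Fact quot_mulA : associative quot_mul.
Proof.
move=> x y z; rewrite -[x]quot_proj_repr -[y]quot_proj_repr -[z]quot_proj_repr.
by rewrite -!quot_projM mulrA.
Qed.

Fact quot_mulC : commutative quot_mul.
Proof. by move=> x y; rewrite /quot_mul mulrC. Qed.

Fact quot_mul1 : left_id quot_one quot_mul.
Proof.
by move=> x; rewrite -[x]quot_proj_repr -quot_projM mul1r.
Qed.

Fact quot_mulDl : left_distributive quot_mul +%R.
Proof.
move=> x y z; rewrite -[x]quot_proj_repr -[y]quot_proj_repr -[z]quot_proj_repr.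
by rewrite -raddfD -!quot_projM -raddfD mulrDl.
Qed.

HB.instance Definition _ := GRing.Zmodule_isComPzRing.Build quot_ring
  quot_mulA quot_mulC quot_mul1 quot_mulDl.

Fact quot_proj_is_monoid_morphism : monoid_morphism quot_proj.
Proof. by split=> // x y; rewrite quot_projM. Qed.

HB.instance Definition _ := GRing.isMonoidMorphism.Build R quot_ring quot_proj
  quot_proj_is_monoid_morphism.

End QuotientRing.

Section QuotientLift.
Variables (R S : comPzRingType) (I : ideal R) (f : {rmorphism R -> S}).
Variable fI : forall x, I x -> f x = 0.

(* The morphism [R / I -> S] induced by [f].                                  *)
Definition quot_lift of (forall x, I x -> f x = 0) : quot_ring I -> S :=
  fun x => f (repr x).

Lemma quot_lift_proj x : quot_lift fI (quot_proj I x) = f x.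
Proof.
apply/eqP; rewrite -subr_eq0 -rmorphB fI //.
by apply/quot_projP; rewrite quot_proj_repr.
Qed.

Fact quot_lift_is_zmod_morphism : zmod_morphism (quot_lift fI).
Proof.
move=> x y; rewrite -[x]quot_proj_repr -[y]quot_proj_repr -raddfB.
by rewrite !quot_lift_proj rmorphB.
Qed.

Fact quot_lift_is_monoid_morphism : monoid_morphism (quot_lift fI).
Proof.
split=> [|x y]; first by rewrite -(rmorph1 (quot_proj I)) quot_lift_proj rmorph1.
rewrite -[x]quot_proj_repr -[y]quot_proj_repr -rmorphM.
by rewrite !quot_lift_proj rmorphM.
Qed.

HB.instance Definition _ := GRing.isZmodMorphism.Build (quot_ring I) S
  (quot_lift fI) quot_lift_is_zmod_morphism.
HB.instance Definition _ := GRing.isMonoidMorphism.Build (quot_ring I) S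
  (quot_lift fI) quot_lift_is_monoid_morphism.

End QuotientLift.

Section ResidueField.
Variables (R : comPzRingType) (p : prime_ideal R).

Definition quot_dom : Type := quot_ring p.

HB.instance Definition _ := GRing.ComPzRing.on quot_dom.

Fact quot_dom_nonzero : (1 : quot_dom) != 0.
Proof.
apply/eqP => /= one0; apply: (prime_ideal_proper (p := p)).
rewrite -[1]subr0; apply/quot_projP.
by rewrite [LHS](rmorph1 (quot_proj p)) [RHS](raddf0 (quot_proj p)).
Qed.

HB.instance Definition _ :=
  GRing.PzSemiRing_isNonZero.Build quot_dom quot_dom_nonzero.

Definition quot_dom_unit : pred quot_dom :=
  fun x => `[< exists y, y * x = 1 >].
Definition quot_dom_inv (x : quot_dom) : quot_dom :=
  if pselect (exists y, y * x = 1) is left h then projT1 (cid h) else x.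

Fact quot_dom_mulV : {in quot_dom_unit, left_inverse 1 quot_dom_inv *%R}.
Proof.
move=> x /asboolP ux; rewrite /quot_dom_inv.
by case: pselect => // h; exact: (projT2 (cid h)).
Qed.

Fact quot_dom_unitP (x y : quot_dom) : y * x = 1 -> quot_dom_unit x.
Proof. by move=> xy; apply/asboolP; exists y. Qed.

Fact quot_dom_inv_out : {in [predC quot_dom_unit], quot_dom_inv =1 id}.
Proof.
by move=> x /negP nux; rewrite /quot_dom_inv; case: pselect => // h;
   case: nux; apply/asboolP.
Qed.

HB.instance Definition _ := GRing.ComNzRing_hasMulInverse.Build quot_dom
  quot_dom_mulV quot_dom_unitP quot_dom_inv_out.

Fact quot_ring_integral (x y : quot_ring p) : x * y = 0 -> x = 0 \/ y = 0.
Proof.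
have zeroE (z : quot_ring p) : z = 0 <-> p (repr z).
  rewrite -{1}[z]quot_proj_repr -(raddf0 (quot_proj p)).
  by rewrite quot_projP subr0.
rewrite -{1}[x]quot_proj_repr -{1}[y]quot_proj_repr -rmorphM.
rewrite -{1}(raddf0 (quot_proj p)) quot_projP subr0 !zeroE.
exact: prime_ideal_mul.
Qed.

Fact quot_dom_integral (x y : quot_dom) : x * y = 0 -> (x == 0) || (y == 0).
Proof. by move=> /quot_ring_integral[] /eqP ->; rewrite ?orbT. Qed.

HB.instance Definition _ :=
  GRing.ComUnitRing_isIntegral.Build quot_dom quot_dom_integral.

Definition residue_field : fieldType := {fraction quot_dom}.

Definition quot_dom_proj : R -> quot_dom := quot_proj p.

Fact quot_dom_proj_is_zmod_morphism : zmod_morphism quot_dom_proj.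
Proof. exact: (raddfB (quot_proj p)). Qed.

Fact quot_dom_proj_is_monoid_morphism : monoid_morphism quot_dom_proj.
Proof.
by split; [exact: (rmorph1 (quot_proj p)) | exact: (rmorphM (quot_proj p))].
Qed.

HB.instance Definition _ := GRing.isZmodMorphism.Build R quot_dom quot_dom_proj
  quot_dom_proj_is_zmod_morphism.
HB.instance Definition _ := GRing.isMonoidMorphism.Build R quot_dom
  quot_dom_proj quot_dom_proj_is_monoid_morphism.

(* The value at the point [p] of the function [a].                            *)
Definition residue (a : R) : residue_field := tofrac (quot_dom_proj a).

HB.instance Definition _ :=
  GRing.RMorphism.copy residue (@tofrac quot_dom \o quot_dom_proj).

End ResidueField.

Definition has_prime_chain (R : comPzRingType) (d : nat) : Prop :=
  exists p : nat -> prime_ideal R, forall i, (i < d)%N ->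
    (forall x, p i x -> p i.+1 x) /\ (exists x, p i.+1 x /\ ~ p i x).

(* The zero ring (the empty scheme) has no dimension in [nat].                *)
Definition krull_dim (R : comPzRingType) (d : nat) : Prop :=
  has_prime_chain R d /\ (forall e, has_prime_chain R e -> (e <= d)%N).

(* An affine [K]-scheme is given by a ring [B] together with its structure    *)
(* morphism [K -> B]; isomorphisms of [K]-schemes are isomorphisms of         *)
(* [K]-algebras.                                                              *)
Definition global_complete_intersection (K : fieldType) (B : comPzRingType)
    (str : {rmorphism K -> B}) : Prop :=
  exists (m c : nat) (f : 'I_c -> {mpoly K[m]}),
    let Q := quot_ring (span (fun q => exists i, q = f i)) in
    (exists phi : {rmorphism Q -> B}, bijective phi /\
       forall a : K, phi (quot_proj _ a%:MP) = str a) /\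
    (c <= m)%N /\ krull_dim Q (m - c).

Section SpecialLinear.
Variables (k : fieldType) (n : nat).

Definition generic_mx : 'M[{mpoly k[n.+1 * n.+1]}]_n.+1 :=
  \matrix_(i, j) 'X_(mxvec_index i j).

Definition SL_ideal : ideal {mpoly k[n.+1 * n.+1]} :=
  span (fun q => q = \det generic_mx - 1).

Definition SL_ring : comPzRingType := quot_ring SL_ideal.

Definition SL_const (a : k) : SL_ring := quot_proj SL_ideal a%:MP.

HB.instance Definition _ := GRing.RMorphism.copy SL_const
  (quot_proj SL_ideal \o @mpolyC (n.+1 * n.+1) k).

(* [L x U x L x U] is an affine space: each factor has one free coordinate    *)
(* for every pair [(i, j)] with [j < i].  The coordinate [(s, (i, j))] is the *)
(* entry [(i, j)] of the factor [s] if this factor is lower triangular, and   *)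
(* its entry [(j, i)] if it is upper triangular.                              *)
Definition strict_pair : finType := {p : 'I_n.+1 * 'I_n.+1 | (p.2 < p.1)%N}.
Definition LULU_coord : finType := ('I_4 * strict_pair)%type.

Definition lower_mx (s : 'I_4) : 'M[{mpoly k[#|LULU_coord|]}]_n.+1 :=
  \matrix_(i, j) if insub (i, j) is Some t then 'X_(enum_rank (s, t))
                 else (i == j)%:R.
Definition upper_mx (s : 'I_4) : 'M[{mpoly k[#|LULU_coord|]}]_n.+1 :=
  (lower_mx s)^T.

Definition mu_mx : 'M[{mpoly k[#|LULU_coord|]}]_n.+1 :=
  lower_mx (inord 0) *m upper_mx (inord 1) *m
  lower_mx (inord 2) *m upper_mx (inord 3).

Fact det_lower_mx s : \det (lower_mx s) = 1.
Proof.
rewrite det_trig; last first.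
  apply/is_trig_mxP => i j lt_ij; rewrite mxE insubF ?ltn_eqF //=.
    by case: eqP lt_ij => // ->; rewrite ltnn.
  by rewrite ltnNge ltnW.
by rewrite big1 // => i _; rewrite mxE insubF ?eqxx //= ltnn.
Qed.

Fact det_mu_mx : \det mu_mx = 1.
Proof. by rewrite !det_mulmx !det_tr !det_lower_mx !mulr1. Qed.

(* The comorphism of [mu], first on the coordinate ring of all matrices.      *)
Definition mu_eval : {mpoly k[n.+1 * n.+1]} -> {mpoly k[#|LULU_coord|]} :=
  mmap (@mpolyC #|LULU_coord| k) (fun e => mxvec mu_mx 0 e).

HB.instance Definition _ := GRing.RMorphism.on mu_eval.

Fact mu_eval_generic : map_mx mu_eval generic_mx = mu_mx.
Proof. by apply/matrixP => i j; rewrite !mxE /mu_eval mmapX mmap1U mxvecE mxE. Qed.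

Fact mu_eval_SL q : SL_ideal q -> mu_eval q = 0.
Proof.
pose kerI := @Ideal _ (fun q => mu_eval q = 0) (rmorph0 _)
  (fun x y (x0 : mu_eval x = 0) (y0 : mu_eval y = 0) =>
     etrans (rmorphD _ x y) (etrans (congr2 +%R x0 y0) (addr0 0)))
  (fun a x (x0 : mu_eval x = 0) =>
     etrans (rmorphM _ a x) (etrans (congr1 ( *%R _) x0) (mulr0 _))).
move=> /(_ kerI); apply=> _ -> /=.
by rewrite rmorphB rmorph1 -det_map_mx mu_eval_generic det_mu_mx subrr.
Qed.

Definition mu_comorphism : {rmorphism SL_ring -> {mpoly k[#|LULU_coord|]}} :=
  quot_lift mu_eval_SL.

End SpecialLinear.

Arguments SL_const : clear implicits.
Arguments mu_comorphism : clear implicits.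

(* The fiber over the point [p] of [Spec A] of the morphism of [k]-schemes    *)
(* [A^N -> Spec A] with comorphism [phi] is the spectrum of the tensor        *)
(* product of [k[t_1, ..., t_N]] and [residue_field p] over [A], that is, of  *)
(* the quotient of [k[t_1, ..., t_N]] extended to [residue_field p] by the    *)
(* elements identifying [phi a] with the value of [a] at [p].                 *)
Section Fiber.
Variables (k : fieldType) (A : comPzRingType) (const : {rmorphism k -> A}).
Variables (N : nat) (phi : {rmorphism A -> {mpoly k[N]}}) (p : prime_ideal A).

Definition fiber_ideal : ideal {mpoly (residue_field p)[N]} :=
  span (fun q => exists a : A,
    q = map_mpoly (residue p \o const) (phi a) - (residue p a)%:MP).

Definition fiber_ring : comPzRingType := quot_ring fiber_ideal.

Definition fiber_const (x : residue_field p) : fiber_ring :=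
  quot_proj fiber_ideal x%:MP.

HB.instance Definition _ := GRing.RMorphism.copy fiber_const
  (quot_proj fiber_ideal \o @mpolyC N (residue_field p)).

End Fiber.

Arguments fiber_const [k A] const [N] phi p x.

(* Main.v *)
Require Import Defs.
From HB Require Import structures.
From mathcomp Require Import all_boot all_order all_algebra.
From mathcomp Require Import zify.
From mathcomp Require Import fraction boolp mpoly.

Set Implicit Arguments.
Unset Strict Implicit.
Unset Printing Implicit Defensive.

Import GRing.Theory.
Local Open Scope ring_scope.

(** Let [K] be the residue field at the point and [g] the matrix of determinant 1
    which the point defines over [K].  With [x' = x^-1] and [v' = v^-1] the
    equation [x u y v = g] of the fiber reads [u y = x' g v'].  These are
    [(n+1)^2] equations in [2n(n+1)] coordinates, one too many for the expected
    dimension.  But the equation in the top left corner follows from the others: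
    both sides have determinant 1, and the cofactor at that corner is the
    determinant of a product of unitriangular matrices, hence 1
    ([corner_redundant]).  It remains to show that the scheme cut out by the other
    [(n+1)^2 - 1] equations has dimension [2n(n+1) - (n+1)^2 + 1 = n^2].

    Peel off the last row and the last column of [u y = x' g v'].  If [(a, 1)] is
    the last row of [x'] and [(b, 1)] the last column of [v'], the corner equation
    is [(a, 1) g (b, 1)^T = 1], the last row of [y] and the last column of [u] are
    determined, and what is left is the same problem for a smaller matrix
    [reduced_mx g a b], again of determinant 1 ([peel_factorization]).  So the fiber
    is a tower of hypersurfaces, one in an affine space of dimension [2m] for every
    [m = n, ..., 1], and [n^2] is the sum of the numbers [2m - 1].

    Upper bound.  Choosing an element in each step of a chain of primes gives
    elements that are algebraically independent modulo the smallest prime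
    ([chain_monomials_free]).  In the residue field of that prime all coordinates are
    rational functions of [n^2] elements: a bilinear equation
    [(a, 1) g (b, 1)^T = 1] with invertible [g] always expresses one of the [2m]
    unknowns rationally through the others ([factorization_rational]).  Counting
    monomials, more than [d] elements of a field generated by [d] elements are
    algebraically dependent ([rational_dependent]).

    Lower bound.  The same equation can be solved for one unknown near a suitable
    point with values in [K].  This yields a point of the fiber with values in the
    local ring at the origin of the affine space of dimension [n^2], such that the
    coordinates of the affine space are, up to constants, values of functions on the
    fiber ([factorization_local]).  Pulling back the primes
    [0 < (t_1) < (t_1, t_2) < ...] gives a chain of length [n^2]; in particular the
    fiber is not empty. *)

(** * Ideals and chains of primes *)

Lemma ideal_sum (R : comPzRingType) (I : ideal R) (T : Type) (r : seq T)
    (P : pred T) (F : T -> R) :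
  (forall i, P i -> I (F i)) -> I (\sum_(i <- r | P i) F i).
Proof.
by move=> IF; elim/big_ind: _ => //; [exact: ideal_zero | exact: ideal_add].
Qed.

Lemma ideal_opp (R : comPzRingType) (I : ideal R) x : I x -> I (- x).
Proof. by move=> Ix; rewrite -mulN1r; apply: ideal_mul. Qed.

Lemma ideal_sub (R : comPzRingType) (I : ideal R) x y :
  I x -> I y -> I (x - y).
Proof. by move=> Ix Iy; apply: ideal_add => //; apply: ideal_opp. Qed.

Lemma prime_cancel_exp (R : comPzRingType) (p : prime_ideal R) x y s :
  ~ p x -> p (x ^+ s * y) -> p y.
Proof.
move=> npx; elim: s => [|s IHs]; first by rewrite mul1r.
by rewrite exprS -mulrA => /prime_ideal_mul[//|].
Qed.

(** The elements [x i], one in each step of the chain, are algebraically independent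
    modulo [p 0].  In a relation modulo [p 0], look at the monomials with the
    smallest exponent of [x 0]: after cancelling that power of [x 0], which is
    not in [p 0], all the other monomials vanish modulo [p 1], so these form a
    relation among [x 1], [x 2], ... modulo [p 1].  After [e] steps a single
    nonzero scalar is left in [p e]. *)
Lemma chain_monomials_free (K : fieldType) (A : comPzRingType)
    (str : {rmorphism K -> A}) (p : nat -> prime_ideal A) (e : nat)
    (x : nat -> A) :
  (forall i, (i < e)%N -> forall y, p i y -> p i.+1 y) ->
  (forall i, (i < e)%N -> p i.+1 (x i) /\ ~ p i (x i)) ->
  forall N (c : {ffun 'I_e -> 'I_N} -> K),
  p 0%N (\sum_a str (c a) * \prod_(i < e) x i ^+ a i) -> forall a, c a = 0.
Proof.
move=> p_le p_x N c p0c a; apply/eqP/negPn/negP => ca_neq0.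
(* [S] collects the monomials that survive the first [e] steps; they agree in
   all exponents, so that there is only one. *)
suff [S [agreeS /set0Pn[b Sb] nzS pS]] : exists S : {set {ffun 'I_e -> 'I_N}},
    [/\ forall b b', b \in S -> b' \in S -> forall j : 'I_e, (j < e)%N -> b j = b' j,
        S != set0, forall b, b \in S -> c b != 0 &
        p e (\sum_(b in S) str (c b) * \prod_(j < e | (e <= j)%N) x j ^+ b j)].
  have Sb' b' : (b' \in S) = (b' == b).
    apply/idP/eqP => [Sb'|->//]; apply/ffunP => j; exact: agreeS.
  move: pS; rewrite (eq_bigl _ _ Sb') big_pred1_eq big1; last first.
    by move=> j; rewrite leqNgt ltn_ord.
  rewrite mulr1 => pcb; case: (@prime_ideal_proper _ (p e)).
  rewrite -(rmorph1 str) -(mulVf (nzS b Sb)) rmorphM; exact: ideal_mul.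
suff: forall i, (i <= e)%N -> exists S : {set {ffun 'I_e -> 'I_N}},
    [/\ forall b b', b \in S -> b' \in S -> forall j : 'I_e, (j < i)%N -> b j = b' j,
        S != set0, forall b, b \in S -> c b != 0 &
        p i (\sum_(b in S) str (c b) * \prod_(j < e | (i <= j)%N) x j ^+ b j)].
  by apply.
elim=> [_|i IHi lt_ie].
  exists [set b | c b != 0]; split=> //; first by apply/set0Pn; exists a; rewrite inE.
    by move=> b; rewrite inE.
  rewrite big_mkcond /= (eq_bigr (fun b => str (c b) * \prod_(i < e) x i ^+ b i)) //.
  by move=> b _; rewrite inE; case: eqP => [->|//]; rewrite rmorph0 mul0r.
have [S [agreeS /set0Pn[b Sb] nzS pS]] := IHi (ltnW lt_ie).
pose io := Ordinal lt_ie.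
have [b0 Sb0 min_b0] := arg_minnP (fun b : {ffun 'I_e -> 'I_N} => b io : nat) Sb.
have [p_xi np_xi] := p_x i lt_ie.
pose tl (b : {ffun 'I_e -> 'I_N}) := \prod_(j < e | (i < j)%N) x j ^+ b j.
have /prime_cancel_exp pT : p i (x i ^+ b0 io *
    \sum_(b in S) str (c b) * (x i ^+ (b io - b0 io) * tl b)).
  move: pS; congr (p i _); rewrite mulr_sumr; apply: eq_bigr => b' Sb'.
  rewrite [RHS]mulrCA [X in _ = _ * X]mulrA -exprD subnKC ?min_b0 //; congr (_ * _).
  rewrite (bigD1 io) //=; congr (_ * _); apply: eq_bigl => j.
  by rewrite ltn_neqAle eq_sym andbC.
have {}pT := p_le _ lt_ie _ (pT np_xi).
exists [set b' in S | b' io == b0 io]; split.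
- move=> b1 b2; rewrite !inE => /andP[Sb1 /eqP b1i] /andP[Sb2 /eqP b2i] j.
  rewrite ltnS leq_eqVlt => /orP[/eqP ji|]; last exact: agreeS.
  have -> : j = io by apply: val_inj.
  by rewrite b1i.
- by apply/set0Pn; exists b0; rewrite inE eqxx andbT.
- by move=> b'; rewrite inE => /andP[/nzS].
move: pT; rewrite (bigID (fun b' : {ffun 'I_e -> 'I_N} => b' io == b0 io)) /=.
set s1 := (X in X + _); set s2 := (X in _ + X) => ps.
have ps2 : p i.+1 s2.
  apply: ideal_sum => b' /andP[Sb' ne_b'].
  have lt_b' : (b0 io < b' io)%N by rewrite ltn_neqAle min_b0 // eq_sym andbT ne_b'.
  rewrite -(subnSK lt_b') exprS -mulrA mulrCA mulrC.
  by apply: ideal_mul.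
have: p i.+1 s1 by rewrite -(addrK s2 s1); apply: ideal_sub.
congr (p i.+1 _); apply: eq_big => b'; first by rewrite inE.
by case/andP=> _ /eqP ->; rewrite subnn mul1r.
Qed.

(** * Algebraic dependence of rational functions *)

Section RationalFunctions.
Variables (K E : fieldType) (str : {rmorphism K -> E}).

(** The subfield generated by [str K] and the elements [z i]. *)
Definition rational_in d (z : 'I_d -> E) : pred E := fun x =>
  `[< exists P H : {mpoly K[d]}, mmap str z H != 0 /\
        x = mmap str z P / mmap str z H >].

Lemma rational_in_divring d (z : 'I_d -> E) : GRing.divring_closed (rational_in z).
Proof.
split=> [|x y|x y].
- by apply/asboolP; exists 1, 1; rewrite rmorph1 divr1 oner_neq0.
- move=> /asboolP[P [H [H0 ->]]] /asboolP[P' [H' [H'0 ->]]].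
  apply/asboolP; exists (P * H' - P' * H), (H * H').
  rewrite !rmorphB !rmorphM /= mulf_neq0 //; split=> //.
  by rewrite -[- (_ / _)]mulNr addf_div // mulNr.
- move=> /asboolP[P [H [H0 ->]]] /asboolP[P' [H' [H'0 ->]]].
  have [P'0|P'0] := eqVneq (mmap str z P') 0.
    apply/asboolP; exists 0, 1; rewrite rmorph0 rmorph1 P'0.
    by rewrite !mul0r invr0 mulr0 oner_neq0.
  apply/asboolP; exists (P * H'), (H * P').
  by rewrite !rmorphM mulf_neq0 // invf_div mulf_div.
Qed.

HB.instance Definition _ d (z : 'I_d -> E) :=
  GRing.isDivringClosed.Build E (rational_in z) (rational_in_divring z).

Lemma rational_in_const d (z : 'I_d -> E) a : str a \in rational_in z.
Proof.
by apply/asboolP; exists a%:MP, 1; rewrite rmorph1 divr1 oner_neq0 mmapC.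
Qed.

Lemma rational_in_gen d (z : 'I_d -> E) i : z i \in rational_in z.
Proof.
by apply/asboolP; exists 'X_i, 1; rewrite rmorph1 divr1 oner_neq0 mmapX mmap1U.
Qed.

(** [msize] is the total degree plus one; this form makes the bound additive. *)
Definition degree_le d k (P : {mpoly K[d]}) := (msize P <= k.+1)%N.

Lemma degree_leM d k l (P H : {mpoly K[d]}) :
  degree_le k P -> degree_le l H -> degree_le (k + l) (P * H).
Proof.
rewrite /degree_le; have [->|P0] := eqVneq P 0; first by rewrite mul0r msize0.
have [->|H0] := eqVneq H 0; first by rewrite mulr0 msize0.
move=> Pk Hl; rewrite msizeM //; move: Pk Hl.
by move: (mmeasure _ P) (mmeasure _ H) => a b; lia.
Qed.

Lemma degree_leX d k s (P : {mpoly K[d]}) :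
  degree_le k P -> degree_le (s * k) (P ^+ s).
Proof.
move=> Pk; elim: s => [|s IHs]; first by rewrite /degree_le expr0 msize1.
by rewrite exprS mulSn; apply: degree_leM.
Qed.

Lemma degree_le_prod d k e (P : 'I_e -> {mpoly K[d]}) :
  (forall i, degree_le k (P i)) -> degree_le (e * k) (\prod_i P i).
Proof.
elim: e P => [|e IHe] P Pk; first by rewrite big_ord0 /degree_le msize1.
by rewrite big_ord_recl mulSn; apply: degree_leM => //; apply: IHe.
Qed.

Lemma card_monomials d B : (#|{: 'X_{1..d < B}}| <= B ^ d)%N.
Proof.
have ltB (m : 'X_{1..d < B}) i : (m i < B)%N.
  apply: leq_ltn_trans (bmdeg m); rewrite mdegE (bigD1 i) //=; exact: leq_addr.
pose f (m : 'X_{1..d < B}) : {ffun 'I_d -> 'I_B} := [ffun i => Ordinal (ltB m i)].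
have f_inj : injective f.
  move=> m m' /ffunP eq_f; apply/val_inj/mnmP => i.
  by have /(congr1 val) := eq_f i; rewrite !ffunE.
rewrite -[X in (B ^ X)%N]card_ord -[X in (X ^ _)%N]card_ord -card_ffun.
exact: leq_card f_inj.
Qed.

Lemma more_rows_dependent (I J : finType) (M : I -> J -> K) :
  (#|J| < #|I|)%N ->
  exists c : I -> K, (exists i, c i != 0) /\ forall j, \sum_i c i * M i j = 0.
Proof.
move=> ltJI.
pose A : 'M[K]_(#|I|, #|J|) := \matrix_(i, j) M (enum_val i) (enum_val j).
have /rowV0Pn[v /sub_kermxP vA v0] : kermx A != 0.
  by rewrite kermx_eq0 /row_free ltn_eqF // (leq_ltn_trans (rank_leq_col A)).
exists (fun i => v 0 (enum_rank i)); split.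
  have [i vi] := rV0Pn _ v0; exists (enum_val i); by rewrite enum_valK.
move=> j; transitivity ((v *m A) 0 (enum_rank j)); last by rewrite vA mxE.
rewrite mxE (reindex enum_rank) /=; last by exists enum_val => ? _; rewrite ?enum_rankK ?enum_valK.
by apply: eq_bigr => i _; rewrite mxE !enum_rankK.
Qed.

(** Counting: bring the [y i] to the form [P i / H i].  The [N ^ e] monomials
    in [y] with exponents below [N], multiplied by a common denominator, are
    polynomials in [z] of degree at most [N * e * D], of which there is a space of
    dimension at most [(N * C) ^ d].  As [d < e], this is smaller for large [N]. *)
Lemma rational_dependent d e (z : 'I_d -> E) (y : 'I_e -> E) :
  (d < e)%N -> (forall i, y i \in rational_in z) ->
  exists N (c : {ffun 'I_e -> 'I_N} -> K), (exists a, c a != 0) /\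
    \sum_a str (c a) * \prod_i y i ^+ a i = 0.
Proof.
move=> lt_de y_in.
have /choice[PH y_rat] i : exists PH : {mpoly K[d]} * {mpoly K[d]},
    mmap str z PH.2 != 0 /\ y i = mmap str z PH.1 / mmap str z PH.2.
  by have /asboolP[P [H ?]] := y_in i; exists (P, H).
pose P i := (PH i).1; pose H i := (PH i).2.
pose D := (\max_i maxn (msize (P i)) (msize (H i)))%N.
have PD i : degree_le D (P i).
  by rewrite /degree_le ltnW // ltnS /D (bigD1 i) //= !leq_max leqnn.
have HD i : degree_le D (H i).
  by rewrite /degree_le ltnW // ltnS /D (bigD1 i) //= !leq_max leqnn orbT.
pose C := (e * D).+1; pose N := (C ^ d).+1.
pose G (a : {ffun 'I_e -> 'I_N}) := \prod_i (P i ^+ a i * H i ^+ (N - a i)).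
have GD a : degree_le (e * (N * D)) (G a).
  apply: degree_le_prod => i.
  have := degree_leM (degree_leX (a i) (PD i)) (degree_leX (N - a i) (HD i)).
  by rewrite -mulnDl subnKC // ltnW.
pose B := (N * C)%N.
have ltB a : (msize (G a) <= B)%N.
  apply: leq_trans (GD a) _; rewrite /B /C mulnS (mulnCA e) -add1n leq_add2r.
  by rewrite /N.
(* The choice of [N] gives [C ^ d < N], hence [(N * C) ^ d < N ^ d.+1 <= N ^ e]. *)
have [|c [c0 cG]] := @more_rows_dependent {ffun 'I_e -> 'I_N} 'X_{1..d < B}
    (fun a m => (G a)@_m).
  apply: leq_ltn_trans (card_monomials d B) _.
  rewrite card_ffun !card_ord /B expnMn.
  apply: (@leq_trans (N ^ d * N)); first by rewrite ltn_pmul2l // expn_gt0.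
  by rewrite -expnSr leq_pexp2l.
exists N, c; split=> //.
have : \sum_a c a *: G a = 0.
  apply/mpolyP => m; rewrite mcoeff0 raddf_sum /=.
  have [ltm|gem] := ltnP (mdeg m) B.
    by rewrite -[RHS](cG (BMultinom ltm)); apply: eq_bigr => a _; rewrite mcoeffZ.
  rewrite big1 // => a _; rewrite mcoeffZ memN_msupp_eq0 ?mulr0 //.
  by apply: msize_mdeg_ge; apply: leq_trans gem.
move/(congr1 (mmap str z)); rewrite rmorph0 rmorph_sum /= => eq0.
apply: (mulfI (x := \prod_i mmap str z (H i) ^+ N)).
  by apply/prodf_neq0 => i _; rewrite expf_neq0 //; case: (y_rat i).
rewrite mulr0 -[RHS]eq0 mulr_sumr; apply: eq_bigr => a _.
rewrite mmapZ mulrCA; congr (_ * _).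
rewrite -big_split /= /G rmorph_prod; apply: eq_bigr => i _.
have [Hi0 {1}->] := y_rat i.
rewrite rmorphM !rmorphXn /= expr_div_n mulrCA; congr (_ * _).
rewrite -{1}(subnK (ltnW (ltn_ord (a i)))) exprD mulfK //.
by rewrite expf_neq0.
Qed.

End RationalFunctions.

(** If [A] modulo [p 0] embeds into a field of rational functions in [d] elements,
    then no chain starting at [p 0] is longer than [d]. *)
Lemma chain_length_le (K E : fieldType) (A : comPzRingType)
    (str : {rmorphism K -> A}) (f : {rmorphism A -> E})
    (p : nat -> prime_ideal A) (e d : nat) (z : 'I_d -> E) :
  (forall a, f a = 0 -> p 0%N a) ->
  (forall a, f a \in rational_in (f \o str) z) ->
  (forall i, (i < e)%N ->
     (forall x, p i x -> p i.+1 x) /\ exists x, p i.+1 x /\ ~ p i x) ->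
  (e <= d)%N.
Proof.
move=> kerf f_rat chain; rewrite leqNgt; apply/negP => lt_de.
have /choice[x px] i : exists x, (i < e)%N -> p i.+1 x /\ ~ p i x.
  case: (ltnP i e) => [/chain[_ [x ?]]|_]; by [exists x | exists 0].
have [|N [c [[a ca] eq0]]] := @rational_dependent K E (f \o str) d e z
  (fun i : 'I_e => f (x i)) lt_de.
  by move=> i; apply: f_rat.
have c0 : forall a, c a = 0.
  apply: (chain_monomials_free (str := str) (p := p) (x := x)) => //.
    by move=> i /chain[].
  apply: kerf; rewrite -[RHS]eq0 rmorph_sum; apply: eq_bigr => b _ /=.
  rewrite rmorphM rmorph_prod; congr (_ * _).
  by apply: eq_bigr => i _; rewrite rmorphXn.
by rewrite c0 eqxx in ca.
Qed.

(** * Unitriangular matrices and the last row and column *)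

Definition unilower (R : pzRingType) m (A : 'M[R]_m) :=
  forall i j : 'I_m, (i <= j)%N -> A i j = (i == j)%:R.

Definition uniupper (R : pzRingType) m (A : 'M[R]_m) := unilower A^T.

Lemma unilower_block (R : pzRingType) m (A : 'M[R]_m) (a : 'rV_m) :
  unilower A -> unilower (block_mx A 0 a 1%:M).
Proof.
move=> lA i j; rewrite -[i]splitK -[j]splitK.
case: (split i) => i'; case: (split j) => j' /=;
  rewrite ?block_mxEul ?block_mxEur ?block_mxEdl ?block_mxEdr.
- by move/lA ->; rewrite (inj_eq (@lshift_inj _ _)).
- by rewrite mxE eq_lrshift.
- by rewrite leqNgt (leq_trans (ltn_ord j')) // leq_addr.
- by rewrite mxE (inj_eq (@rshift_inj _ _)).
Qed.

Lemma uniupper_block (R : pzRingType) m (A : 'M[R]_m) (a : 'cV_m) :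
  uniupper A -> uniupper (block_mx A a 0 1%:M).
Proof. by move=> uA; rewrite /uniupper tr_block_mx trmx0 trmx1; apply: unilower_block. Qed.

Lemma unilowerP (R : pzRingType) m (A : 'M[R]_(m + 1)) :
  unilower A -> exists A1 a, A = block_mx A1 0 a 1%:M /\ unilower A1.
Proof.
move=> lA; exists (ulsubmx A), (dlsubmx A); split; last first.
  by move=> i j le_ij; rewrite !mxE lA // (inj_eq (@lshift_inj _ _)).
rewrite -{1}[A]submxK; congr block_mx; apply/matrixP => i j; rewrite !mxE lA //=.
- by rewrite eq_lrshift.
- by rewrite ltnW // (leq_trans (ltn_ord i)) // leq_addr.
- by rewrite (inj_eq (@rshift_inj _ _)).
- by rewrite leq_add2l !ord1.
Qed.

Lemma uniupperP (R : pzRingType) m (A : 'M[R]_(m + 1)) :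
  uniupper A -> exists A1 a, A = block_mx A1 a 0 1%:M /\ uniupper A1.
Proof.
move=> /unilowerP[A1 [a [EA lA]]]; exists A1^T, a^T.
by rewrite /uniupper trmxK -[A]trmxK EA tr_block_mx trmx0 trmx1.
Qed.

Lemma det_unilower (R : comPzRingType) m (A : 'M[R]_m) : unilower A -> \det A = 1.
Proof.
move=> lA; rewrite det_trig; last first.
  apply/is_trig_mxP => i j lt_ij; have /lA -> := ltnW lt_ij.
  by case: eqP lt_ij => // ->; rewrite ltnn.
by rewrite big1 // => i _; rewrite lA // eqxx.
Qed.

Lemma det_uniupper (R : comPzRingType) m (A : 'M[R]_m) : uniupper A -> \det A = 1.
Proof. by rewrite -det_tr => /det_unilower. Qed.

Lemma unilower_map (R S : pzRingType) (f : {rmorphism R -> S}) m (A : 'M[R]_m) :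
  unilower A -> unilower (map_mx f A).
Proof. by move=> lA i j /lA; rewrite mxE => ->; rewrite rmorph_nat. Qed.

Lemma uniupper_map (R S : pzRingType) (f : {rmorphism R -> S}) m (A : 'M[R]_m) :
  uniupper A -> uniupper (map_mx f A).
Proof. by rewrite /uniupper map_trmx; apply: unilower_map. Qed.

Lemma unilower_inverse (R : pzRingType) m (x : 'M[R]_m) :
  unilower x -> exists y, unilower y /\ x *m y = 1%:M.
Proof.
elim: m x => [|m IHm] x lx; first by exists x; split=> //; apply/matrixP; case.
rewrite -[m.+1]addn1 in x lx *.
have [x1 [a [-> /IHm[y1 [ly1 xy1]]]]] := unilowerP lx.
exists (block_mx y1 0 (- (a *m y1)) 1%:M); split; first exact: unilower_block.
rewrite mulmx_block !(mul0mx, mulmx0, mul1mx, mulmx1, add0r, addr0) xy1.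
by rewrite subrr -scalar_mx_block.
Qed.

Lemma unilower_adj (R : comPzRingType) m (x : 'M[R]_m) :
  unilower x -> unilower (\adj x).
Proof.
move=> lx; have [y [ly xy]] := unilower_inverse lx.
by rewrite -[\adj x]mulmx1 -xy mulmxA mul_adj_mx det_unilower // mul1mx.
Qed.

Lemma adj_involutive (R : comPzRingType) m (x : 'M[R]_m) :
  \det x = 1 -> \adj (\adj x) = x.
Proof.
move=> det_x.
have det_adj : \det (\adj x) = 1.
  by rewrite -[LHS]mulr1 -[X in _ * X]det_x -det_mulmx mul_adj_mx det_x det1.
by rewrite -[LHS]mulmx1 -[X in X%:M]det_x -mul_adj_mx mulmxA mul_adj_mx det_adj mul1mx.
Qed.

Lemma uniupper_adj (R : comPzRingType) m (x : 'M[R]_m) :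
  uniupper x -> uniupper (\adj x).
Proof. by rewrite /uniupper trmx_adj; apply: unilower_adj. Qed.

(** The matrix left over when the last row of [x] and the last column of [v] have
    been peeled off; it is the Schur complement of the last corner of
    [x *m g *m v] when this corner is 1. *)
Definition reduced_mx (R : pzRingType) m (g : 'M[R]_(m + 1)) (a : 'rV[R]_m)
    (b : 'cV[R]_m) : 'M[R]_m :=
  ulsubmx g - (ulsubmx g *m b + ursubmx g) *m (a *m ulsubmx g + dlsubmx g).

(** The four blocks of [u *m y = x *m g *m v].  The corner gives one equation in
    [a] and [b], the off-diagonal blocks determine [e] and [c], and subtracting the
    product [c *m e] from the main block gives the same kind of equation in smaller
    size. *)
Lemma peel_factorization (R : pzRingType) m (g : 'M[R]_(m + 1))
    (x u y v : 'M[R]_m) (a e : 'rV[R]_m) (c b : 'cV[R]_m) :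
  block_mx u c 0 1%:M *m block_mx y 0 e 1%:M =
    block_mx x 0 a 1%:M *m g *m block_mx v b 0 1%:M <->
  [/\ a *m (ulsubmx g *m b + ursubmx g) + (dlsubmx g *m b + drsubmx g) = 1%:M,
      e = (a *m ulsubmx g + dlsubmx g) *m v,
      c = x *m (ulsubmx g *m b + ursubmx g) &
      u *m y = x *m reduced_mx g a b *m v].
Proof.
rewrite -{1}[g]submxK !mulmx_block.
rewrite !(mul0mx, mulmx0, mul1mx, mulmx1, add0r, addr0).
set g1 := ulsubmx g; set gc := ursubmx g; set r := dlsubmx g; set d := drsubmx g.
have E1 : (a *m g1 + r) *m b + (a *m gc + d) = a *m (g1 *m b + gc) + (r *m b + d).
  by rewrite mulmxDl mulmxDr mulmxA !addrA; congr (_ + _); rewrite addrAC.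
have E2 : x *m g1 *m b + x *m gc = x *m (g1 *m b + gc) by rewrite mulmxDr mulmxA.
rewrite E1 E2 /reduced_mx -/g1 -/gc -/r.
have E3 : x *m (g1 - (g1 *m b + gc) *m (a *m g1 + r)) *m v =
    x *m g1 *m v - (x *m (g1 *m b + gc)) *m ((a *m g1 + r) *m v).
  by rewrite mulmxBr mulmxBl !mulmxA.
rewrite E3; split.
  by move=> /eq_block_mx[<- -> -> <-]; split=> //; rewrite addrK.
by case=> -> -> -> ->; rewrite subrK.
Qed.

(** * Rational generation *)

Lemma rpred_det (R : comUnitRingType) (F : divringClosed R) m (A : 'M[R]_m) :
  A \is a mxOver F -> \det A \in F.
Proof.
move=> /mxOverP AF; apply: rpred_sum => s _.
by rewrite rpredM ?rpredX ?rpredN ?rpred1 // rpred_prod.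
Qed.

Lemma mxOver_adj (R : comUnitRingType) (F : divringClosed R) m (A : 'M[R]_m) :
  A \is a mxOver F -> \adj A \is a mxOver F.
Proof.
move=> /mxOverP AF; apply/mxOverP => i j; rewrite mxE /cofactor.
rewrite rpredM ?rpredX ?rpredN ?rpred1 //; apply: rpred_det.
by apply/mxOverP => k l; rewrite !mxE.
Qed.

Lemma mxOver_of_adj (R : comUnitRingType) (F : divringClosed R) m (x : 'M[R]_m) :
  \det x = 1 -> \adj x \is a mxOver F -> x \is a mxOver F.
Proof. by move=> /adj_involutive {2}<-; apply: mxOver_adj. Qed.

Lemma mxOver_block (T : Type) (F : {pred T}) m1 m2 n1 n2 (A : 'M[T]_(m1, n1))
    (B : 'M_(m1, n2)) (C : 'M_(m2, n1)) (D : 'M_(m2, n2)) :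
  A \is a mxOver F -> B \is a mxOver F -> C \is a mxOver F -> D \is a mxOver F ->
  block_mx A B C D \is a mxOver F.
Proof.
move=> /mxOverP AF /mxOverP BF /mxOverP CF /mxOverP DF; apply/mxOverP => i j.
rewrite -[i]splitK -[j]splitK; case: (split i) => i'; case: (split j) => j' /=;
  by rewrite ?block_mxEul ?block_mxEur ?block_mxEdl ?block_mxEdr.
Qed.

Lemma reduced_mxOver (R : pzRingType) (F : subringClosed R) m (g : 'M[R]_(m + 1))
    (a : 'rV[R]_m) (b : 'cV[R]_m) :
  g \is a mxOver F -> a \is a mxOver F -> b \is a mxOver F ->
  [/\ ulsubmx g *m b + ursubmx g \is a mxOver F,
      a *m ulsubmx g + dlsubmx g \is a mxOver F &
      reduced_mx g a b \is a mxOver F].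
Proof.
move=> /mxOverP gF aF bF.
have g1F : ulsubmx g \is a mxOver F by apply/mxOverP => i j; rewrite !mxE.
have gcF : ursubmx g \is a mxOver F by apply/mxOverP => i j; rewrite !mxE.
have grF : dlsubmx g \is a mxOver F by apply/mxOverP => i j; rewrite !mxE.
have wF : ulsubmx g *m b + ursubmx g \is a mxOver F.
  by apply: rpredD => //; apply: mxOverM.
have w'F : a *m ulsubmx g + dlsubmx g \is a mxOver F.
  by apply: rpredD => //; apply: mxOverM.
by split=> //; apply: rpredB => //; apply: mxOverM.
Qed.

(** The corner equation says that [a *m w + s = 1] for
    [w = ulsubmx g *m b + ursubmx g] and a scalar [s].  If an entry [w i 0] is not 0,
    then [a 0 i] is rational in [b] and the other entries of [a].  If [w = 0], then
    [g] maps the column [(b, 1)] to [(0, 1)], so that [b] is determined by [g]. *)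
Lemma hyperbola_rational (E : fieldType) m (g : 'M[E]_(m + 1)) (a : 'rV_m)
    (b : 'cV_m) :
  \det g = 1 ->
  a *m (ulsubmx g *m b + ursubmx g) + (dlsubmx g *m b + drsubmx g) = 1%:M ->
  exists z : seq E, size z = (m + m).-1 /\
    forall F : divringClosed E, g \is a mxOver F -> {subset z <= F} ->
      a \is a mxOver F /\ b \is a mxOver F.
Proof.
move=> det_g eq1; pose w := ulsubmx g *m b + ursubmx g.
have subE (F : divringClosed E) : g \is a mxOver F ->
    [/\ ulsubmx g \is a mxOver F, ursubmx g \is a mxOver F,
        dlsubmx g \is a mxOver F & drsubmx g \is a mxOver F].
  by move/mxOverP=> gF; split; apply/mxOverP => i j; rewrite !mxE.
have [w0|/cV0Pn[i wi]] := eqVneq w 0.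
  have eqb : col_mx b 1%:M = \adj g *m col_mx 0 1%:M :> 'cV_(m + 1).
    rewrite -[LHS]mul1mx -[X in X%:M *m _]det_g -mul_adj_mx -mulmxA; congr (_ *m _).
    rewrite -{1}[g]submxK mul_block_col !mulmx1; congr col_mx => //.
    by rewrite -eq1 -/w w0 mulmx0 add0r.
  (* The zeros only bring the list to the required length. *)
  exists ([seq a 0 i | i <- enum 'I_m] ++ nseq m.-1 0); split.
    rewrite size_cat size_map size_enum_ord size_nseq.
    by case: (m) => // m'; rewrite addnS.
  move=> F gF zF; split.
    apply/mxOverP => i j; rewrite ord1; apply: zF; rewrite mem_cat.
    by apply/orP; left; apply: map_f; rewrite mem_enum.
  have: col_mx b 1%:M \is a mxOver F.
    rewrite eqb; apply: mxOverM; first exact: mxOver_adj.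
    apply/mxOverP => i j; rewrite mxE; case: splitP => k _; rewrite !mxE ?rpred0 //.
    by rewrite rpred_nat.
  move/mxOverP => bF; apply/mxOverP => i j.
  by have := bF (lshift 1 i) j; rewrite col_mxEu.
exists ([seq b i 0 | i <- enum 'I_m] ++ [seq a 0 j | j <- enum (predC1 i)]); split.
  rewrite size_cat (size_map _ (enum _)) (size_map _ (enum (predC1 i))) size_enum_ord.
  rewrite -cardE cardC1 card_ord.
  by case: (m) i {a b g w wi subE det_g eq1} => [[]|] // m' _; rewrite addnS.
move=> F gF zF; have [gF1 gFc gFr gFd] := subE F gF.
have bF : b \is a mxOver F.
  apply/mxOverP => j k; rewrite ord1; apply: zF; rewrite mem_cat.
  by apply/orP; left; apply: (map_f (fun i => b i 0)); rewrite mem_enum.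
have wF : w \is a mxOver F by apply: rpredD => //; apply: mxOverM.
have aF j : j != i -> a 0 j \in F.
  move=> ji; apply: zF; rewrite mem_cat; apply/orP; right.
  by apply: (map_f (fun j => a 0 j)); rewrite mem_enum.
split=> //; apply/mxOverP => k j; rewrite [k]ord1 {k}; have [->|/aF//] := eqVneq j i.
move/mxOverP: wF => wF.
have sF : dlsubmx g *m b + drsubmx g \is a mxOver F.
  by apply: rpredD => //; apply: mxOverM.
move/matrixP/(_ 0 0): eq1; rewrite -/w [LHS]mxE [RHS]mxE eqxx mxE (bigD1 i) //=.
set s := \sum_(j | _) _; set t := fun_of_matrix _ 0 0 => eq1.
have -> : a 0 i = (1 - t - s) / w i 0.
  by apply: (mulIf wi); rewrite divfK // -[1]eq1 addrK addrK.
rewrite rpred_div ?rpredB ?rpred1 //; first by move/mxOverP: sF; apply.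
by apply: rpred_sum => k ki; rewrite rpredM ?aF.
Qed.

(** Each size [k.+1] contributes [2k - 1] generators, and the sum of these numbers for
    [0 < k < m] is [(m - 1)^2].  The generators must not depend on [F], so that the
    induction can be applied to the reduced matrix, whose entries lie only in the
    field generated at the first step. *)
Lemma factorization_rational (E : fieldType) m (g x u y v : 'M[E]_m) :
  unilower x -> uniupper u -> unilower y -> uniupper v ->
  u *m y = x *m g *m v ->
  exists z : seq E, size z = (m.-1 ^ 2)%N /\
    forall F : divringClosed E, g \is a mxOver F -> {subset z <= F} ->
      [/\ x \is a mxOver F, u \is a mxOver F, y \is a mxOver F & v \is a mxOver F].
Proof.
elim: m g x u y v => [|m IHm] g x u y v lx uu ly uv eq_uy.
  by exists [::]; split=> // F _ _; split; apply: flatmxOver.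
rewrite -[m.+1]addn1 in g x u y v lx uu ly uv eq_uy *.
have det_g : \det g = 1.
  have := congr1 determinant eq_uy; rewrite !det_mulmx.
  by rewrite !(det_unilower lx, det_uniupper uu, det_unilower ly, det_uniupper uv) !(mul1r, mulr1).
have [x1 [a [Ex lx1]]] := unilowerP lx; have [u1 [c [Eu uu1]]] := uniupperP uu.
have [y1 [e [Ey ly1]]] := unilowerP ly; have [v1 [b [Ev uv1]]] := uniupperP uv.
move: eq_uy; rewrite Ex Eu Ey Ev => /peel_factorization[eq1 Ee Ec eq_uy1].
have [z1 [sz1 z1F]] := hyperbola_rational det_g eq1.
have [z2 [sz2 z2F]] := IHm _ _ _ _ _ lx1 uu1 ly1 uv1 eq_uy1.
exists (z1 ++ z2); split.
  by rewrite size_cat sz1 sz2 addn1 /=; case: (m) => // m'; rewrite -!mulnn; lia.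
move=> F gF zF.
have [aF bF] : a \is a mxOver F /\ b \is a mxOver F.
  by apply: z1F => // t t_in; apply: zF; rewrite mem_cat t_in.
have [wF w'F redF] := reduced_mxOver gF aF bF.
have [|x1F u1F y1F v1F] := z2F F redF.
  by move=> t t_in; apply: zF; rewrite mem_cat t_in orbT.
have F1 : (1%:M : 'M[E]_1) \is a mxOver F by apply: mxOver_scalar; rewrite ?rpred0 ?rpred1.
have F0 k l : (0 : 'M[E]_(k, l)) \is a mxOver F by apply: mxOver0; rewrite rpred0.
have eF : e \is a mxOver F by rewrite Ee; apply: mxOverM.
have cF : c \is a mxOver F by rewrite Ec; apply: mxOverM.
by split; apply: mxOver_block.
Qed.

(** * Points with values in a local ring *)

(** [O] is a local ring with a coefficient field: the residue field [K] of [O] is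
    embedded into [O] by [cst]. *)
Section LocalPoint.
Variables (K : fieldType) (O : comNzRingType).
Variables (cst : {rmorphism K -> O}) (rho : {rmorphism O -> K}).
Hypothesis rho_cst : cancel cst rho.
Hypothesis rho_unit : forall a, rho a != 0 -> exists b, a * b = 1.

Lemma det_reduced_mx m (g : 'M[O]_(m + 1)) (a : 'rV_m) (b : 'cV_m) :
  \det g = 1 ->
  a *m (ulsubmx g *m b + ursubmx g) + (dlsubmx g *m b + drsubmx g) = 1%:M ->
  \det (reduced_mx g a b) = 1.
Proof.
move=> det_g eq1.
have /(congr1 determinant) : block_mx 1%:M (ulsubmx g *m b + ursubmx g) 0 1%:M *m
    block_mx (reduced_mx g a b) 0 (a *m ulsubmx g + dlsubmx g) 1%:M =
    block_mx 1%:M 0 a 1%:M *m g *m block_mx 1%:M b 0 1%:M.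
  by apply/peel_factorization; split; rewrite ?mulmx1 ?mul1mx.
rewrite !det_mulmx !det_ublock !det_lblock !det1 det_g.
by rewrite !(mul1r, mulr1).
Qed.

(** If [ulsubmx g *m b + ursubmx g] were 0 for all [b], the upper rows of [g] would
    be 0.  So a suitable [b] exists over every field, even a finite one. *)
Lemma last_column_moves m (g : 'M[K]_(m.+1 + 1)) :
  \det g = 1 -> exists b i, (ulsubmx g *m b + ursubmx g) i 0 != 0.
Proof.
move=> det_g; apply: contrapT => no_b.
have w0 b : ulsubmx g *m b + ursubmx g = 0.
  apply/matrixP => i j; rewrite [RHS]mxE ord1; apply/eqP/negPn/negP => wi.
  by apply: no_b; exists b, i.
have gc0 : ursubmx g = 0 by rewrite -(w0 0) mulmx0 add0r.
have g10 : ulsubmx g = 0.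
  apply/matrixP => i j; have := w0 (delta_mx j 0).
  by rewrite gc0 addr0 -colE => /matrixP/(_ i 0); rewrite [in X in X = _ -> _]mxE !mxE.
move: det_g; rewrite -[g]submxK gc0 det_lblock g10 det0 mul0r => /eqP.
by rewrite eq_sym oner_eq0.
Qed.

(** Near a value [b0] of [b] at which some entry [w i0 0] of the coefficient vector of
    [a] does not vanish, this entry is invertible, so that [a 0 i0] is a function of
    all the other entries, and these can be chosen freely. *)
Lemma hyperbola_local m (g : 'M[O]_(m + 1)) (t : nat -> O) :
  \det g = 1 -> (forall i, rho (t i) = 0) ->
  exists (a : 'rV_m) (b : 'cV_m),
  a *m (ulsubmx g *m b + ursubmx g) + (dlsubmx g *m b + drsubmx g) = 1%:M /\
  forall i, (i < (m + m).-1)%N ->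
    exists l j, a 0 j = t i + cst l \/ b j 0 = t i + cst l.
Proof.
case: m g => [|m] g det_g rho_t.
  exists 0, 0; split=> //; rewrite mul0mx mulmx0 !add0r; apply/matrixP => i j.
  rewrite !ord1 [RHS]mxE eqxx mulr1n -[RHS]det_g det_mx11 !mxE.
  by congr (g _ _); apply: val_inj.
have det_rg : \det (map_mx rho g) = 1 by rewrite det_map_mx det_g rmorph1.
have [b0 [i0 wi0]] := last_column_moves det_rg.
pose b : 'cV_m.+1 := \col_j (t j + cst (b0 j 0)).
pose w := ulsubmx g *m b + ursubmx g.
pose s := (dlsubmx g *m b + drsubmx g) 0 0.
have rho_w : rho (w i0 0) != 0.
  suff -> : rho (w i0 0) = (ulsubmx (map_mx rho g) *m b0 + ursubmx (map_mx rho g)) i0 0 by [].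
  rewrite /w !mxE rmorphD rmorph_sum; congr (_ + _); apply: eq_bigr => j _.
  by rewrite !mxE rmorphM rmorphD rho_t add0r rho_cst.
have [c wc] := rho_unit rho_w.
(* The entries of [b] use [t 0], ..., [t m]; the entries of [a] other than
   [a 0 i0] use the next [m] parameters in order. *)
pose a' j := t (m.+1 + unbump i0 j)%N.
pose a : 'rV_m.+1 := \row_j if j == i0 then
   (1 - s - \sum_(k | k != i0) a' k * w k 0) * c else a' j.
exists a, b; split.
  apply/matrixP => i j; rewrite !ord1 [RHS]mxE eqxx [LHS]mxE -/s mxE (bigD1 i0) //= -/w.
  rewrite mxE eqxx -mulrA [c * _]mulrC wc mulr1 -[RHS](subrK s); congr (_ + _).
  rewrite -[RHS](subrK (\sum_(k | k != i0) a' k * w k 0)); congr (_ + _).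
  by apply: eq_bigr => k /negPf ki; rewrite mxE ki.
move=> i lt_i; have [lt_im|le_mi] := ltnP i m.+1.
  by exists (b0 (Ordinal lt_im) 0), (Ordinal lt_im); right; rewrite mxE.
have ltb : (bump i0 (i - m.+1) < m.+1)%N.
  by move: (leq_b1 (i0 <= i - m.+1)%N) lt_i le_mi; rewrite /bump; lia.
exists 0, (Ordinal ltb); left; rewrite mxE -val_eqE /= [_ == _]eq_sym (negPf (neq_bump _ _)).
by rewrite /a' /= bumpK subnKC // rmorph0 addr0.
Qed.

Lemma factorization_local m (g : 'M[O]_m) (t : nat -> O) :
  \det g = 1 -> (forall i, rho (t i) = 0) ->
  exists x u y v : 'M[O]_m,
  [/\ unilower x, uniupper u, unilower y & uniupper v] /\
  u *m y = x *m g *m v /\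
  forall i, (i < m.-1 ^ 2)%N ->
    exists l j k, x j k = t i + cst l \/ v j k = t i + cst l.
Proof.
elim: m g t => [|m IHm] g t det_g rho_t.
  exists 0, 0, 0, 0; split; last split=> //.
    by split=> i; case: i.
  by apply/matrixP => i; case: i.
rewrite -[m.+1]addn1 in g det_g *.
have [a [b [eq1 ab_t]]] := hyperbola_local det_g rho_t.
have [|x1 [u1 [y1 [v1 [[lx uu ly uv] [eq_uy xv_t]]]]]] :=
  IHm (reduced_mx g a b) (fun i => t (i + (m + m).-1)%N) (det_reduced_mx det_g eq1).
  by move=> i; apply: rho_t.
exists (block_mx x1 0 a 1%:M).
exists (block_mx u1 (x1 *m (ulsubmx g *m b + ursubmx g)) 0 1%:M).
exists (block_mx y1 0 ((a *m ulsubmx g + dlsubmx g) *m v1) 1%:M).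
exists (block_mx v1 b 0 1%:M).
split; first by split; do ?[exact: unilower_block | exact: uniupper_block].
split; first exact/peel_factorization.
move=> i lt_i'; have {lt_i'} lt_i : (i < m ^ 2)%N by move: lt_i'; rewrite {1}addn1.
have [lt_im|le_mi] := ltnP i (m + m).-1.
  have [l [j [at_i|bt_i]]] := ab_t i lt_im.
    by exists l, (rshift m 0), (lshift 1 j); left; rewrite block_mxEdl.
  by exists l, (lshift 1 j), (rshift m 0); right; rewrite block_mxEur.
have [|l [j [k xv]]] := xv_t (i - (m + m).-1)%N.
  by case: (m) lt_i le_mi => // m'; rewrite -!mulnn /=; lia.
by exists l, (lshift 1 j), (lshift 1 k); rewrite !block_mxEul -(subnK le_mi).
Qed.

End LocalPoint.

(** * Local rings of affine space *)

Lemma mpoly_morph_ext (K : fieldType) (S : comPzRingType) d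
    (f g : {rmorphism {mpoly K[d]} -> S}) :
  (forall a, f a%:MP = g a%:MP) -> (forall i, f 'X_i = g 'X_i) -> f =1 g.
Proof.
move=> fgC fgX P; rewrite [P]mpolyE !rmorph_sum; apply: eq_bigr => m _.
rewrite -mul_mpolyC !rmorphM fgC; congr (_ * _).
rewrite mpolyXE_id !rmorph_prod; apply: eq_bigr => i _.
by rewrite !rmorphXn fgX.
Qed.

Section Localization.
Variables (R : idomainType) (K : fieldType) (rho : {rmorphism R -> K}).

Definition regular : pred {fraction R} := fun a =>
  `[< exists P H : R, rho H != 0 /\ a = tofrac P / tofrac H >].

Lemma tofrac_neq0 H : rho H != 0 -> tofrac H != 0.
Proof. by apply: contraNneq => /eqP; rewrite tofrac_eq0 => /eqP ->; rewrite rmorph0. Qed.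

Lemma regular_subring : subring_closed regular.
Proof.
split=> [|x y|x y].
- by apply/asboolP; exists 1, 1; rewrite !rmorph1 divr1 oner_neq0.
- move=> /asboolP[P [H [H0 ->]]] /asboolP[P' [H' [H'0 ->]]].
  apply/asboolP; exists (P * H' - P' * H), (H * H').
  rewrite rmorphM mulf_neq0 //; split=> //; rewrite rmorphB !rmorphM.
  by rewrite -[- (_ / _)]mulNr addf_div ?tofrac_neq0 // mulNr.
- move=> /asboolP[P [H [H0 ->]]] /asboolP[P' [H' [H'0 ->]]].
  apply/asboolP; exists (P * P'), (H * H').
  by rewrite !rmorphM mulf_neq0 // mulf_div.
Qed.

HB.instance Definition _ := GRing.isSubringClosed.Build {fraction R} regular
  regular_subring.

Record local_ring := LocalRing { local_val : {fraction R}; _ : local_val \in regular }.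

HB.instance Definition _ := [isSub for local_val].
HB.instance Definition _ := [Choice of local_ring by <:].
HB.instance Definition _ := [SubChoice_isSubComNzRing of local_ring by <:].

(** The localization of a domain at the kernel of [rho], as a subring of the field of
    fractions.  The statement keeps only its universal property, in the form of maps
    to fields. *)
Lemma localization_exists : exists (O : comNzRingType) (loc : {rmorphism R -> O}),
  [/\ forall a : O, exists P H, rho H != 0 /\ a * loc H = loc P,
      forall H, rho H != 0 -> exists b, loc H * b = 1 &
      forall (L : fieldType) (f : {rmorphism R -> L}),
        (forall H, rho H != 0 -> f H != 0) ->
        exists fO : {rmorphism O -> L}, forall P, fO (loc P) = f P].
Proof.
pose O : comNzRingType := local_ring.
have reg_loc P : tofrac P \in regular.
  by apply/asboolP; exists P, 1; rewrite !rmorph1 divr1 oner_neq0.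
pose loc P : O := LocalRing (reg_loc P).
have loc_zmod : zmod_morphism loc by move=> P H; apply: val_inj; rewrite /= rmorphB.
have loc_monoid : monoid_morphism loc.
  by split=> [|P H]; apply: val_inj; rewrite /= ?rmorph1 ?rmorphM.
pose locZ := GRing.isZmodMorphism.Build R O loc loc_zmod.
pose locM := GRing.isMonoidMorphism.Build R O loc loc_monoid.
pose locR : {rmorphism R -> O} := HB.pack loc locZ locM.
have fracO (a : O) : exists PH : R * R, rho PH.2 != 0 /\ a * locR PH.2 = locR PH.1.
  have /asboolP[P [H [H0 Ea]]] := valP a; exists (P, H); split=> //.
  by apply: val_inj; rewrite /= Ea divfK // tofrac_neq0.
exists O, locR; split.
- by move=> a; have [[P H]] := fracO a; exists P, H.
- move=> H H0; have regV : (tofrac H)^-1 \in regular.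
    by apply/asboolP; exists 1, H; rewrite rmorph1 mul1r.
  by exists (LocalRing regV); apply: val_inj; rewrite /= divff // tofrac_neq0.
move=> L f f0; have [nd ndP] := choice fracO.
pose fO (a : O) := f (nd a).1 / f (nd a).2.
have fOE a P H : rho H != 0 -> a * locR H = locR P -> fO a = f P / f H.
  move=> H0 aHP; have [n0 aE] := ndP a; apply/eqP.
  rewrite /fO eqr_div ?f0 // -!rmorphM; apply/eqP; congr (f _); apply/eqP.
  rewrite -tofrac_eq; apply/eqP; suff /(congr1 val) :
    locR ((nd a).1 * H) = locR (P * (nd a).2) by [].
  by rewrite !rmorphM -aE -aHP mulrAC.
have fO_zmod : zmod_morphism fO.
  move=> a b; have [Ha Ea] := ndP a; have [Hb Eb] := ndP b.
  rewrite (@fOE _ ((nd a).1 * (nd b).2 - (nd b).1 * (nd a).2) ((nd a).2 * (nd b).2)).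
  - by rewrite rmorphB !rmorphM /fO -[- (_ / _)]mulNr addf_div ?f0 // mulNr.
  - by rewrite rmorphM mulf_neq0.
  - rewrite rmorphB !rmorphM -Ea -Eb mulrBl; congr (_ - _); first by rewrite mulrA.
    by rewrite mulrA mulrAC.
have fO_monoid : monoid_morphism fO.
  split=> [|a b].
    by rewrite (@fOE _ 1 1) ?rmorph1 ?divr1 ?oner_neq0 ?mulr1.
  have [Ha Ea] := ndP a; have [Hb Eb] := ndP b.
  rewrite (@fOE _ ((nd a).1 * (nd b).1) ((nd a).2 * (nd b).2)).
  - by rewrite !rmorphM /fO mulf_div.
  - by rewrite rmorphM mulf_neq0.
  - by rewrite !rmorphM -Ea -Eb mulrACA.
pose fZ := GRing.isZmodMorphism.Build O L fO fO_zmod.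
pose fM := GRing.isMonoidMorphism.Build O L fO fO_monoid.
pose fOR : {rmorphism O -> L} := HB.pack fO fZ fM.
exists fOR => P /=.
by rewrite (@fOE _ P 1) ?rmorph1 ?divr1 ?oner_neq0 ?mulr1.
Qed.

End Localization.

Section Kernel.
Variables (A B : comPzRingType) (f : {rmorphism A -> B}).

Fact kernel_add x y : f x = 0 -> f y = 0 -> f (x + y) = 0.
Proof. by move=> fx fy; rewrite rmorphD fx fy addr0. Qed.

Fact kernel_mul a x : f x = 0 -> f (a * x) = 0.
Proof. by move=> fx; rewrite rmorphM fx mulr0. Qed.

Definition kernel : ideal A :=
  @Ideal A (fun x => f x = 0) (rmorph0 f) kernel_add kernel_mul.

End Kernel.

Section KernelPrime.
Variables (A : comPzRingType) (L : fieldType) (f : {rmorphism A -> L}).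

Fact kernel_proper : ~ kernel f 1.
Proof. by rewrite /= rmorph1; apply/eqP; rewrite oner_eq0. Qed.

Fact kernel_prime x y : kernel f (x * y) -> kernel f x \/ kernel f y.
Proof.
by rewrite /= rmorphM => /eqP; rewrite mulf_eq0 => /orP[]/eqP; [left | right].
Qed.

Definition kernel_prime_ideal : prime_ideal A := PrimeIdeal kernel_proper kernel_prime.

End KernelPrime.

Section Specializations.
Variables (K : fieldType) (d : nat).

Definition origin : {mpoly K[d]} -> K := mmap idfun (fun=> 0).

HB.instance Definition _ := GRing.RMorphism.on origin.

(** Its kernel is the prime ideal generated by the first [i] variables. *)
Definition kill_vars (i : nat) : {mpoly K[d]} -> {mpoly K[d]} :=
  mmap (@mpolyC d K) (fun j : 'I_d => if (j < i)%N then 0 else 'X_j).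

HB.instance Definition _ i := GRing.RMorphism.on (kill_vars i).

Lemma originC a : origin a%:MP = a.
Proof. exact: mmapC. Qed.

Lemma originX j : origin 'X_j = 0.
Proof. by rewrite /origin mmapX mmap1U. Qed.

Lemma kill_varsC i a : kill_vars i a%:MP = a%:MP.
Proof. exact: mmapC. Qed.

Lemma kill_varsX i (j : 'I_d) : kill_vars i 'X_j = if (j < i)%N then 0 else 'X_j.
Proof. by rewrite /kill_vars mmapX mmap1U. Qed.

Lemma origin_kill i P : origin (kill_vars i P) = origin P.
Proof.
apply: (mpoly_morph_ext (f := origin \o kill_vars i)) => [a|j] /=.
  by rewrite kill_varsC.
by rewrite kill_varsX originX; case: ifP => _; rewrite ?rmorph0 ?originX.
Qed.

Lemma kill_varsK i P : kill_vars i.+1 (kill_vars i P) = kill_vars i.+1 P.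
Proof.
apply: (mpoly_morph_ext (f := kill_vars i.+1 \o kill_vars i)) => [a|j] /=.
  by rewrite !kill_varsC.
rewrite !kill_varsX; case: ifP => [lt_ji|_]; last by rewrite kill_varsX.
by rewrite rmorph0 (ltnW lt_ji : (j < i.+1)%N).
Qed.

(** The kernels of the maps that set the first [i] variables to 0 form a chain of
    primes of [O], and [loc 'X_i] lies in the prime of index [i.+1] but not in that of
    index [i].  The chain stays strict in [A] because the elements [loc 'X_i] come from
    [A]. *)
Lemma prime_chain_of_local_point (A : comPzRingType) (O : comNzRingType)
    (loc : {rmorphism {mpoly K[d]} -> O}) (psi : {rmorphism A -> O}) :
  (forall a : O, exists P H, origin H != 0 /\ a * loc H = loc P) ->
  (forall (L : fieldType) (f : {rmorphism {mpoly K[d]} -> L}),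
     (forall H, origin H != 0 -> f H != 0) ->
     exists fO : {rmorphism O -> L}, forall P, fO (loc P) = f P) ->
  (forall i : 'I_d, exists q, psi q = loc 'X_i) ->
  has_prime_chain A d.
Proof.
move=> fracO ext psiX.
have kill0 i H : origin H != 0 -> (@tofrac {mpoly K[d]} \o kill_vars i) H != 0.
  rewrite /= tofrac_eq0; apply: contraNneq => killH0.
  by rewrite -(origin_kill i) killH0 rmorph0.
have [sp spE] := choice (fun i => ext _ _ (kill0 i)).
have sp0 i a P H : origin H != 0 -> a * loc H = loc P ->
    sp i a = 0 <-> kill_vars i P = 0.
  move=> H0 /(congr1 (sp i)); rewrite rmorphM !spE /= => aHP.
  have H0' : tofrac (kill_vars i H) != 0 by apply: kill0.
  split=> [a0|P0].
    by apply/eqP; rewrite -tofrac_eq0 -aHP a0 mul0r.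
  by move/eqP: aHP; rewrite P0 rmorph0 mulf_eq0 (negPf H0') orbF => /eqP.
exists (fun i => kernel_prime_ideal (sp i \o psi)) => i lt_id; split.
  move=> q /=; have [P [H [H0 aHP]]] := fracO (psi q).
  by rewrite !(sp0 _ _ _ _ H0 aHP) -kill_varsK => ->; rewrite rmorph0.
have [q Eq] := psiX (Ordinal lt_id); exists q; split=> /=.
  by rewrite Eq spE /= kill_varsX /= leqnn rmorph0.
rewrite Eq spE /= kill_varsX /= ltnn => /eqP; rewrite tofrac_eq0 => /eqP.
move/(congr1 (fun P : {mpoly K[d]} => msize P)).
by rewrite msizeX msize0.
Qed.

End Specializations.

(** * The equations of the fiber *)

Lemma move_outer_factors (R : comPzRingType) m (x u y v g : 'M[R]_m) :
  \det x = 1 -> \det v = 1 ->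
  x *m u *m y *m v = g <-> u *m y = \adj x *m g *m \adj v.
Proof.
move=> dx dv; split=> [<-|Euy].
  by rewrite !mulmxA mul_adj_mx dx mul1mx -!mulmxA mul_mx_adj dv mulmx1.
rewrite -[x *m u *m y]mulmxA Euy !mulmxA mul_mx_adj dx mul1mx.
by rewrite -!mulmxA mul_adj_mx dv mulmx1.
Qed.

(** Expand both determinants along the first row: only the term of the corner can
    differ, and its cofactor is that of [u *m y], the determinant of the product of the
    lower right blocks of [u] and [y]. *)
Lemma corner_redundant (R : comPzRingType) n (u y b : 'M[R]_n.+1) :
  uniupper u -> unilower y -> \det b = 1 ->
  (forall i j, (i, j) != (ord0, ord0) -> (u *m y) i j = b i j) ->
  u *m y = b.
Proof.
move=> uu ly det_b eq_ij; apply/matrixP => i j.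
have [[-> ->]|/eq_ij//] := eqVneq (i, j) (ord0, ord0).
have eq_cof k : cofactor (u *m y) ord0 k = cofactor b ord0 k.
  rewrite /cofactor; congr (_ * \det _); apply/matrixP => i' j'; rewrite !mxE.
  by rewrite -eq_ij ?mxE // xpair_eqE negb_and neq_lift.
have u_lo (k l : 'I_n.+1) : (l <= k)%N -> u k l = (k == l)%:R.
  by move/uu; rewrite mxE eq_sym.
have cof1 : cofactor b ord0 ord0 = 1.
  rewrite -eq_cof /cofactor expr0 mul1r.
  pose u1 : 'M_n := \matrix_(k, l) u (lift ord0 k) (lift ord0 l).
  pose y1 : 'M_n := \matrix_(k, l) y (lift ord0 k) (lift ord0 l).
  have -> : row' ord0 (col' ord0 (u *m y)) = u1 *m y1.
    apply/matrixP => k l; rewrite !mxE big_ord_recl u_lo // mul0r add0r.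
    by apply: eq_bigr => j' _; rewrite !mxE.
  rewrite det_mulmx det_uniupper ?det_unilower ?mulr1 //.
    by move=> k l le_kl; rewrite mxE ly // (inj_eq lift_inj).
  by move=> k l le_kl; rewrite !mxE u_lo // (inj_eq lift_inj) eq_sym.
have : \det (u *m y) = \det b.
  by rewrite det_mulmx det_uniupper // det_unilower // mulr1 det_b.
rewrite !(expand_det_row _ ord0) !big_ord_recl eq_cof cof1 !mulr1.
rewrite (eq_bigr (fun k => b ord0 (lift ord0 k) * cofactor b ord0 (lift ord0 k))).
  by move/addIr.
by move=> k _; rewrite eq_cof eq_ij.
Qed.

Lemma map_quot_mxP (R : comPzRingType) (J : ideal R) m (A B : 'M[R]_m) :
  map_mx (quot_proj J) A = map_mx (quot_proj J) B <->
  forall i j, J ((A - B) i j).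
Proof.
split=> [/matrixP eqAB i j|JAB].
  by have := eqAB i j; rewrite !mxE => /quot_projP.
by apply/matrixP => i j; have := JAB i j; rewrite !mxE => /quot_projP.
Qed.

Lemma span_min (R : comPzRingType) (S : R -> Prop) (J : ideal R) :
  (forall s, S s -> J s) -> forall q, Defs.span S q -> J q.
Proof. by move=> SJ q; apply. Qed.

Lemma span_gen (R : comPzRingType) (S : R -> Prop) s : S s -> Defs.span S s.
Proof. by move=> Ss J; apply. Qed.

Lemma ord4P (s : 'I_4) :
  [\/ s = inord 0, s = inord 1, s = inord 2 | s = inord 3].
Proof.
rewrite -[s]inord_val; case: s => -[|[|[|[|//]]]] lt_s4 /=;
  by [constructor 1 | constructor 2 | constructor 3 | constructor 4].
Qed.

Lemma det_middle (R : comPzRingType) m (x v g : 'M[R]_m) :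
  unilower x -> uniupper v -> \det g = 1 -> \det (\adj x *m g *m \adj v) = 1.
Proof.
move=> lx uv det_g; rewrite !det_mulmx det_g (det_unilower (unilower_adj lx)).
by rewrite (det_uniupper (uniupper_adj uv)) !mulr1.
Qed.

Lemma map_corner_redundant (R S : comPzRingType) (f : {rmorphism R -> S}) n
    (u y b : 'M[R]_n.+1) :
  uniupper u -> unilower y -> \det b = 1 ->
  (forall i j, (i, j) != (ord0, ord0) -> f ((u *m y) i j) = f (b i j)) ->
  map_mx f (u *m y) = map_mx f b.
Proof.
move=> uu ly det_b eq_f; rewrite map_mxM; apply: corner_redundant.
- exact: uniupper_map.
- exact: unilower_map.
- by rewrite det_map_mx det_b rmorph1.
by move=> i j ne_ij; rewrite -map_mxM [LHS]mxE [RHS]mxE eq_f.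
Qed.

Lemma map_move_outer_factors (R S : comPzRingType) (f : {rmorphism R -> S}) m
    (x u y v g : 'M[R]_m) :
  unilower x -> uniupper v ->
  map_mx f (x *m u *m y *m v) = map_mx f g <->
  map_mx f (u *m y) = map_mx f (\adj x *m g *m \adj v).
Proof.
move=> lx uv; rewrite !map_mxM !map_mx_adj; apply: move_outer_factors.
  exact/det_unilower/unilower_map.
exact/det_uniupper/uniupper_map.
Qed.

Lemma map_comp_factorization (R S T : comPzRingType) (f : {rmorphism R -> S})
    (h : {rmorphism S -> T}) m (x u y v g : 'M[R]_m) :
  map_mx f (u *m y) = map_mx f (\adj x *m g *m \adj v) ->
  map_mx (h \o f) u *m map_mx (h \o f) y =
    \adj (map_mx (h \o f) x) *m map_mx (h \o f) g *m \adj (map_mx (h \o f) v).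
Proof.
move/(congr1 (map_mx h)).
rewrite (map_mxM f u y) (map_mxM f (_ *m g)) (map_mxM f (\adj x)) 2!(map_mx_adj f).
rewrite (map_mxM h (map_mx f u)) (map_mxM h (_ *m map_mx f g)) (map_mxM h (\adj _)).
by rewrite 2!(map_mx_adj h) -!map_mx_comp.
Qed.

(** * The scheme cut out by the equations *)

Lemma mpoly_value_in (K : fieldType) (E : comPzRingType) d
    (F : subringClosed E) (f : {rmorphism {mpoly K[d]} -> E}) :
  (forall a, f a%:MP \in F) -> (forall i, f 'X_i \in F) -> forall q, f q \in F.
Proof.
move=> FC FX q; rewrite [q]mpolyE rmorph_sum rpred_sum // => m _.
rewrite -mul_mpolyC rmorphM rpredM // mpolyXE_id rmorph_prod rpred_prod // => i _.
by rewrite rmorphXn rpredX.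
Qed.

Section FiberEquations.
Variables (K : fieldType) (n : nat) (g : 'M[K]_n.+1).
Hypothesis det_g : \det g = 1.

Local Notation N := #|LULU_coord n|.
Local Notation P := {mpoly K[N]}.
Local Notation X := (lower_mx K n (inord 0)).
Local Notation U := (upper_mx K n (inord 1)).
Local Notation Y := (lower_mx K n (inord 2)).
Local Notation V := (upper_mx K n (inord 3)).
Local Notation G := (map_mx (@mpolyC N K) g).

Lemma unilower_lower_mx s : unilower (lower_mx K n s).
Proof. by move=> i j le_ij; rewrite mxE insubF //= ltnNge le_ij. Qed.

Lemma uniupper_upper_mx s : uniupper (upper_mx K n s).
Proof. by rewrite /uniupper trmxK; apply: unilower_lower_mx. Qed.

(** Over the polynomial ring, [adj X] and [adj V] are the inverses of [X] and [V],
    which have determinant 1. *)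
Definition fiber_eqs : 'M[P]_n.+1 := U *m Y - \adj X *m G *m \adj V.

Definition off_corner : finType := {p : 'I_n.+1 * 'I_n.+1 | p != (ord0, ord0)}.

Definition fiber_poly (k : 'I_#|off_corner|) : P :=
  let p := val (enum_val k) in fiber_eqs p.1 p.2.

Definition eqs_ideal : ideal P := Defs.span (fun q => exists k, q = fiber_poly k).

Lemma eqs_ideal_entry i j : eqs_ideal (fiber_eqs i j).
Proof.
have det_G : \det G = 1 by rewrite det_map_mx det_g rmorph1.
have detB := det_middle (unilower_lower_mx (inord 0)) (uniupper_upper_mx (inord 3)) det_G.
have redundant := map_corner_redundant (f := quot_proj eqs_ideal)
  (uniupper_upper_mx (inord 1)) (unilower_lower_mx (inord 2)) detB.
have /map_quot_mxP : map_mx (quot_proj eqs_ideal) (U *m Y) =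
    map_mx (quot_proj eqs_ideal) (\adj X *m G *m \adj V); last by apply.
apply: redundant => i' j' ne_ij; apply/quot_projP.
apply: span_gen; exists (enum_rank (exist _ (i', j') ne_ij : off_corner)).
by rewrite /fiber_poly enum_rankK /= /fiber_eqs [RHS]mxE [X in _ = _ + X]mxE.
Qed.

(** The equations in [eqs_ideal] and the entrywise equations [X U Y V = G] generate
    the same ideal; stated by the ideals that contain them. *)
Lemma eqs_ideal_le (J : ideal P) :
  (forall i j, J ((mu_mx K n - G) i j)) <-> (forall q, eqs_ideal q -> J q).
Proof.
have mapE := map_move_outer_factors (quot_proj J) U Y G
  (unilower_lower_mx (inord 0)) (uniupper_upper_mx (inord 3)).
split=> [/map_quot_mxP/mapE/map_quot_mxP JE | IJ].
  by apply: span_min => q [k ->]; apply: JE.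
by apply/map_quot_mxP/mapE/map_quot_mxP => i j; apply/IJ/eqs_ideal_entry.
Qed.

Local Notation Q := (quot_ring eqs_ideal).

Definition quot_cst : K -> Q := quot_proj eqs_ideal \o @mpolyC N K.

HB.instance Definition _ := GRing.RMorphism.on quot_cst.

Lemma quot_factorization (R : comPzRingType) (f : {rmorphism Q -> R}) :
  let F := map_mx (f \o quot_proj eqs_ideal) in
  F U *m F Y = \adj (F X) *m map_mx (f \o quot_cst) g *m \adj (F V).
Proof.
have -> : map_mx (f \o quot_cst) g = map_mx (f \o quot_proj eqs_ideal) G.
  by rewrite -map_mx_comp.
apply: map_comp_factorization; apply/map_quot_mxP; exact: eqs_ideal_entry.
Qed.

Lemma mpolyX_lower_mx s (t : strict_pair n) :
  'X_(enum_rank (s, t)) = lower_mx K n s (val t).1 (val t).2.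
Proof. by rewrite mxE -surjective_pairing valK. Qed.

(** At the smallest prime of a chain, the outer factors of the point are polynomial in
    their inverses, so that all coordinates lie in the field generated by the [n ^ 2]
    elements that generate the factorization [u y = x' g v']. *)
Lemma prime_chain_eqs_le e : has_prime_chain Q e -> (e <= n ^ 2)%N.
Proof.
case=> p chain; pose f : {rmorphism Q -> residue_field (p 0%N)} := residue (p 0%N).
pose h := f \o quot_proj eqs_ideal.
have lX := unilower_map h (unilower_lower_mx (inord 0)).
have uU := uniupper_map h (uniupper_upper_mx (inord 1)).
have lY := unilower_map h (unilower_lower_mx (inord 2)).
have uV := uniupper_map h (uniupper_upper_mx (inord 3)).
have [z [sz zF]] := factorization_rational (unilower_adj lX) uU lY (uniupper_adj uV)
  (quot_factorization f).
pose z' (i : 'I_(n ^ 2)) := z`_i.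
apply: (chain_length_le (str := quot_cst) (f := f) (p := p) (z := z')) chain.
  move=> a /eqP; rewrite tofrac_eq0 => /eqP a0.
  rewrite -[a]subr0; apply/quot_projP; rewrite rmorph0; exact: a0.
have [|t tz|xF uF yF vF] := zF (GRing.DivringClosed.clone _ (rational_in (f \o quot_cst) z') _).
- by apply/mxOverP => i j; rewrite mxE; apply: rational_in_const.
- have lt_t : (index t z < n ^ 2)%N by rewrite -[(n ^ 2)%N]sz index_mem.
  have -> : t = z' (Ordinal lt_t) by rewrite /z' /= nth_index.
  exact: rational_in_gen.
have {}xF := mxOver_of_adj (det_unilower lX) xF.
have {}vF := mxOver_of_adj (det_uniupper uV) vF.
move=> a; rewrite -[a]quot_proj_repr.
apply: (mpoly_value_in (f := h)) => [c|c]; first exact: rational_in_const.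
rewrite -[c]enum_valK; case: (enum_val c) => s t; rewrite mpolyX_lower_mx.
case: (ord4P s) => ->.
- by move/mxOverP: xF => /(_ (val t).1 (val t).2); rewrite mxE.
- by move/mxOverP: uF => /(_ (val t).2 (val t).1); rewrite mxE [upper_mx _ _ _ _ _]mxE.
- by move/mxOverP: yF => /(_ (val t).1 (val t).2); rewrite mxE.
- by move/mxOverP: vF => /(_ (val t).2 (val t).1); rewrite mxE [upper_mx _ _ _ _ _]mxE.
Qed.

End FiberEquations.

Lemma map_fiber_eqs0 (R S : comPzRingType) (f : {rmorphism R -> S}) m
    (x u y v g : 'M[R]_m) :
  map_mx f u *m map_mx f y =
    \adj (map_mx f x) *m map_mx f g *m \adj (map_mx f v) ->
  forall i j, f ((u *m y - \adj x *m g *m \adj v) i j) = 0.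
Proof.
move=> eq_f i j.
have : map_mx f (u *m y) = map_mx f (\adj x *m g *m \adj v).
  by rewrite (map_mxM f u y) (map_mxM f (_ *m g)) (map_mxM f (\adj x)) 2!(map_mx_adj f).
move/matrixP/(_ i j); rewrite [LHS]mxE [RHS]mxE => eq_ij.
by rewrite mxE rmorphD eq_ij [X in _ + f X]mxE rmorphN subrr.
Qed.

Section LowerBound.
Variables (K : fieldType) (n : nat) (g : 'M[K]_n.+1).

Local Notation N := #|LULU_coord n|.
Local Notation P := {mpoly K[N]}.
Local Notation Q := (quot_ring (eqs_ideal g)).

(** Points of the scheme with values in [O].  The matrices [x] and [v] here are the
    outer factors themselves, so their adjugates appear in the equation. *)
Lemma point_of_fiber (O : comNzRingType) (cst : {rmorphism K -> O})
    (x u y v : 'M[O]_n.+1) :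
  unilower x -> uniupper u -> unilower y -> uniupper v ->
  u *m y = \adj x *m map_mx cst g *m \adj v ->
  exists psi : {rmorphism Q -> O},
  [/\ forall a, psi (quot_cst g a) = cst a,
      map_mx (psi \o quot_proj (eqs_ideal g)) (lower_mx K n (inord 0)) = x &
      map_mx (psi \o quot_proj (eqs_ideal g)) (upper_mx K n (inord 3)) = v].
Proof.
move=> lx uu ly uv eq_uy.
pose M (s : 'I_4) : 'M[O]_n.+1 := nth 0 [:: x; u^T; y; v^T] s.
have lM s : unilower (M s) by case: s => -[|[|[|[|//]]]].
have M0 : M (inord 0) = x by rewrite /M inordK.
have M1 : M (inord 1) = u^T by rewrite /M inordK.
have M2 : M (inord 2) = y by rewrite /M inordK.
have M3 : M (inord 3) = v^T by rewrite /M inordK.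
pose h (c : 'I_N) : O :=
  let st : LULU_coord n := enum_val c in M st.1 (val st.2).1 (val st.2).2.
pose F : {rmorphism P -> O} := mmap cst h.
have FE s : map_mx F (lower_mx K n s) = M s.
  apply/matrixP => i j; rewrite !mxE; case: insubP => [t _ tE|].
    by rewrite /F /= mmapX mmap1U /h enum_rankK /= tE.
  by rewrite -leqNgt rmorph_nat => le_ij; rewrite lM.
have FuE s : map_mx F (upper_mx K n s) = (M s)^T by rewrite /upper_mx -map_trmx FE.
have FG : map_mx F (map_mx (@mpolyC N K) g) = map_mx cst g.
  by apply/matrixP => i j; rewrite !mxE /F /= mmapC.
have F0 q : eqs_ideal g q -> F q = 0.
  apply: (span_min (J := kernel F)) => {q} _ [k ->].
  apply: (map_fiber_eqs0 (f := F)).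
  by rewrite !FuE !FE FG M0 M1 M2 M3 !trmxK.
exists (quot_lift F0); split.
- move=> a; exact: etrans (quot_lift_proj F0 a%:MP) (mmapC _ _ _).
- by rewrite -[RHS]M0 -FE; apply: eq_map_mx => q; exact: quot_lift_proj.
- by rewrite -[RHS]trmxK -M3 -FuE; apply: eq_map_mx => q; exact: quot_lift_proj.
Qed.

(** The parameters of the local point are the variables of the affine space; each is an
    entry of [x'] or [v'] minus a constant, hence the value of a function on the
    scheme. *)
Lemma prime_chain_eqs : \det g = 1 -> has_prime_chain Q (n ^ 2).
Proof.
move=> det_g; set d := (n ^ 2)%N.
have [O [loc [fracO unitO extO]]] := localization_exists (@origin K d).
have [|rho rhoE] := extO _ (@origin K d); first by [].
have {}rhoE q : rho (loc q) = origin q := rhoE q.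
pose cst : {rmorphism K -> O} := loc \o @mpolyC d K.
have rho_cst : cancel cst rho by move=> a; exact: etrans (rhoE _) (originC _ _).
have rho_unit a : rho a != 0 -> exists b, a * b = 1.
  have [P' [H [H0 aH]]] := fracO a => a0.
  have P0 : origin P' != 0 by rewrite -rhoE -aH rmorphM rhoE mulf_neq0.
  have [b Pb] := unitO _ P0; exists (loc H * b).
  by rewrite mulrA aH.
pose t (i : nat) : O := if insub i is Some j then loc 'X_(j : 'I_d) else 0.
have rho_t i : rho (t i) = 0.
  by rewrite /t; case: insub => [j|]; rewrite ?rmorph0 // rhoE originX.
have det_g' : \det (map_mx cst g) = 1 by rewrite det_map_mx det_g rmorph1.
have [x [u [y [v [[lx uu ly uv] [eq_uy xv_t]]]]]] :=
  factorization_local rho_cst rho_unit det_g' rho_t.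
have [|psi [psi_cst psiX psiV]] := point_of_fiber
    (unilower_adj lx) uu ly (uniupper_adj uv) (cst := cst).
  by rewrite !adj_involutive ?(det_unilower lx) ?(det_uniupper uv).
apply: (prime_chain_of_local_point (psi := psi) fracO extO) => i.
have [|l [j [k xv]]] := xv_t i; first exact: ltn_ord.
have ti : t i = loc 'X_i by rewrite /t valK.
have imx : exists q, psi q = x j k.
  exists (quot_proj (eqs_ideal g) ((\adj (lower_mx K n (inord 0))) j k)).
  rewrite -[x]adj_involutive ?(det_unilower lx) // -psiX -map_mx_adj.
  by rewrite [RHS]mxE.
have imv : exists q, psi q = v j k.
  exists (quot_proj (eqs_ideal g) ((\adj (upper_mx K n (inord 3))) j k)).
  rewrite -[v]adj_involutive ?(det_uniupper uv) // -psiV -map_mx_adj.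
  by rewrite [RHS]mxE.
have [q Eq] : exists q, psi q = t i + cst l.
  by case: xv => <-.
by exists (q - quot_cst g l); rewrite rmorphB Eq psi_cst addrK ti.
Qed.

End LowerBound.

(** * Counting coordinates *)

Lemma card_strict_pair n : (#|strict_pair n| * 2 = n.+1 * n)%N.
Proof.
have -> : #|strict_pair n| = (\sum_(i < n.+1) i)%N.
  rewrite card_sig -sum1_card big_mkcond /=.
  rewrite -(pair_bigA _ (fun i j : 'I_n.+1 => if (j < i)%N then 1%N else 0%N)) /=.
  apply: eq_bigr => i _; rewrite -big_mkcond sum1_card.
  have widen_inj : injective (widen_ord (ltnW (ltn_ord i))).
    by move=> j j' /(congr1 val) /= ?; apply: val_inj.
  rewrite -[RHS]card_ord -(card_image widen_inj).
  apply: eq_card => j; apply/idP/imageP => [lt_ji|[j' _ ->]]; last exact: ltn_ord j'.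
  by exists (Ordinal lt_ji) => //; apply: val_inj.
elim: n => [|n IHn]; first by rewrite big_ord1.
by rewrite big_ord_recr /= mulnDl IHn; lia.
Qed.

Lemma card_LULU n : #|LULU_coord n| = (2 * (n.+1 * n))%N.
Proof. by rewrite card_prod card_ord -card_strict_pair; lia. Qed.

(** * Fibers of the multiplication map *)

Lemma det_map_generic_mx (R : comPzRingType) (k : fieldType) n
    (f : {rmorphism {mpoly k[n.+1 * n.+1]} -> R}) :
  (forall q, SL_ideal k n q -> f q = 0) -> \det (map_mx f (generic_mx k n)) = 1.
Proof.
move=> f0; rewrite det_map_mx -[RHS](rmorph1 f); apply/eqP.
by rewrite -subr_eq0 -rmorphB f0 //; apply: span_gen.
Qed.

Section FiberIdeal.
Variables (k : fieldType) (n : nat) (g0 : prime_ideal (SL_ring k n)).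

Local Notation K := (residue_field g0).
Local Notation N := #|LULU_coord n|.
Local Notation value := (residue g0 \o quot_proj (SL_ideal k n)).
Local Notation scalar := (residue g0 \o SL_const k n).

(** The point [g0] of the special linear group as a matrix over its residue field. *)
Definition point_mx : 'M[K]_n.+1 := map_mx value (generic_mx k n).

Lemma det_point_mx : \det point_mx = 1.
Proof.
apply: det_map_generic_mx => q Iq /=.
have -> : quot_proj (SL_ideal k n) q = quot_proj (SL_ideal k n) 0.
  by apply/quot_projP; rewrite subr0.
by rewrite !rmorph0.
Qed.

Lemma map_mu_mx : map_mx (map_mpoly scalar) (mu_mx k n) = mu_mx K n.
Proof.
have lowerE s : map_mx (map_mpoly scalar) (lower_mx k n s) = lower_mx K n s.
  apply/matrixP => i j; rewrite !mxE; case: insubP => [t _ _|_].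
    exact: map_mpolyX.
  exact: rmorph_nat.
have upperE s : map_mx (map_mpoly scalar) (upper_mx k n s) = upper_mx K n s.
  by rewrite /upper_mx -map_trmx lowerE.
by rewrite /mu_mx 3!map_mxM !lowerE !upperE.
Qed.

Lemma mu_comorphism_proj q :
  mu_comorphism k n (quot_proj (SL_ideal k n) q) = mu_eval q.
Proof. exact: quot_lift_proj. Qed.

Lemma mu_mx_entry i j : mu_mx K n i j = map_mpoly scalar (mu_eval (generic_mx k n i j)).
Proof.
rewrite -map_mu_mx mxE; congr (map_mpoly _ _).
by rewrite -(mu_eval_generic k n) mxE.
Qed.

(** The fiber ideal is defined by the relations for all functions on the group, but
    both sides of such a relation are ring morphisms in the function, so that the
    relations for the matrix entries suffice. *)
Lemma fiber_ideal_le (J : ideal {mpoly K[N]}) :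
  (forall q, fiber_ideal (SL_const k n) (mu_comorphism k n) g0 q -> J q) <->
  (forall i j, J ((mu_mx K n - map_mx (@mpolyC N K) point_mx) i j)).
Proof.
split=> [FJ i j|JE].
  apply: FJ; apply: span_gen.
  exists (quot_proj (SL_ideal k n) (generic_mx k n i j)).
  rewrite mu_comorphism_proj mxE mu_mx_entry.
  by congr (_ + _); rewrite mxE; congr (- _); rewrite mxE; congr (_%:MP); rewrite mxE.
apply: span_min => _ [a ->]; rewrite -[a]quot_proj_repr; move: (repr a) => {a} q.
rewrite mu_comorphism_proj; apply/quot_projP.
apply: (mpoly_morph_ext (f := quot_proj J \o (map_mpoly scalar \o @mu_eval k n))
  (g := quot_proj J \o (@mpolyC N K \o value))) => [a|c].
  rewrite [LHS]/= /mu_eval mmapC; congr (quot_proj J _); exact: map_mpolyC.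
case/mxvec_indexP: c => i j; apply/quot_projP.
have -> : 'X_(mxvec_index i j) = generic_mx k n i j by rewrite mxE.
have := JE i j; rewrite mxE mu_mx_entry.
by congr (J (_ + _)); rewrite mxE; congr (- _); rewrite mxE; congr (_%:MP); rewrite mxE.
Qed.

Lemma fiber_idealE q :
  fiber_ideal (SL_const k n) (mu_comorphism k n) g0 q <-> eqs_ideal point_mx q.
Proof.
have eqsE J := eqs_ideal_le det_point_mx J.
split=> [Fq|Iq].
  by apply: (proj2 (fiber_ideal_le (eqs_ideal point_mx))) Fq; apply/eqsE.
by apply: (proj1 (eqsE _)) Iq; apply/fiber_ideal_le.
Qed.

End FiberIdeal.

Theorem proposition5p3 (k : fieldType) (n : nat) (n_ge1 : (1 <= n)%N)
    (g0 : prime_ideal (SL_ring k n)) :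
  global_complete_intersection
    (fiber_const (SL_const k n) (mu_comorphism k n) g0).
Proof.
pose K := residue_field g0; pose g := point_mx g0.
have fiberE := @fiber_idealE k n g0.
exists #|LULU_coord n|, #|off_corner n|, (@fiber_poly K n g).
have eqs0 q : eqs_ideal g q ->
    quot_proj (fiber_ideal (SL_const k n) (mu_comorphism k n) g0) q = 0.
  by move/fiberE => Fq; rewrite -(rmorph0 (quot_proj _)); apply/quot_projP; rewrite subr0.
have fiber0 q : fiber_ideal (SL_const k n) (mu_comorphism k n) g0 q ->
    quot_proj (eqs_ideal g) q = 0.
  by move/fiberE => Fq; rewrite -(rmorph0 (quot_proj _)); apply/quot_projP; rewrite subr0.
have card_c : #|off_corner n| = (n.+1 * n.+1).-1.
  by rewrite card_sig (cardC1 (ord0 : 'I_n.+1, ord0 : 'I_n.+1)) card_prod card_ord.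
have eqsK : cancel (quot_lift eqs0) (quot_lift fiber0).
  by move=> q; rewrite -[q]quot_proj_repr (quot_lift_proj eqs0) (quot_lift_proj fiber0).
have fiberK : cancel (quot_lift fiber0) (quot_lift eqs0).
  by move=> q; rewrite -[q]quot_proj_repr (quot_lift_proj fiber0) (quot_lift_proj eqs0).
split; last split.
- exists (quot_lift eqs0); split; last by move=> a; exact: quot_lift_proj.
  by exists (quot_lift fiber0).
- rewrite card_c card_LULU; lia.
have -> : (#|LULU_coord n| - #|off_corner n| = n ^ 2)%N.
  rewrite card_c card_LULU -mulnn; lia.
split; first exact/prime_chain_eqs/det_point_mx.
exact/prime_chain_eqs_le/det_point_mx.
Qed.
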